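(* Let $R$ be a commutative ring with unity such that $M=\operatorname{Der}(R)$ is a free $R$-module of finite rank $m\ge k\ge 1$. Assume that $p\ge k$ and that $\omega\in\Lambda^pM_{fr}^*$ is a reducible meromorphic form written in reduced form $$\omega=\frac{\eta}{f_1\cdots f_k},\qquad \eta\in\Lambda^pM^*,$$ with a reduced divisor $f_1\cdots f_k$ such that its factors $f_1,\dots,f_k$ generate a proper ideal $\mathcal I$ in $R$. Let $\hat f_i$ be the product of $f_1,\dots,f_k$ with $f_i$ omitted. Then the following holds. (i) If $\omega$ satisfies the condition $$df_i\wedge\omega=0\ \bmod\ \sum_j(\hat f_j)^{-1}\Lambda^{p+1}M^*,\qquad i=1,\dots,k,$$ then there exists $n\ge 0$ such that for $b=a^n$, where $a$ is any element of the ideal $I(df_1\wedge\cdots\wedge df_k)$ of $R$, the form $b\,\omega$ can be written as $$b\,\omega=\frac{df_1}{f_1}\wedge\cdots\wedge\frac{df_k}{f_k}\wedge\gamma+\sum_i\frac{\xi_i}{\hat f_i}\qquad(\mathrm{LR})$$ for some regular forms $\gamma\in\Lambda^{p-k}M^*$ and $\xi_i\in\Lambda^pM^*$. (ii) If in addition $\operatorname{depth} I(\overline{df}_1\wedge\cdots\wedge\overline{df}_k)\ge p-k+2$ in the quotient ring $\bar R=R/\mathcal I$, then the representation (LR) holds with $b=1$. (iii) If $R$ is a unique factorization domain and $b\,\omega$ is of the form (LR) with $\bar b$ a non-zero-divisor in $\bar R$, then the meromorphic $(p-k)$-form $\bar b^{-1}\bar\gamma\in\Lambda^{p-k}\bar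 M_{fr}^*$ restricted to $\bar K_{fr}=\ker\overline{df}_1\cap\cdots\cap\ker\overline{df}_k\subset\bar M_{fr}$, $$\mathcal{R}es(\omega):=\bar b^{-1}\bar\gamma\,|_{\bar K_{fr}},$$ is, up to sign, uniquely defined by $\omega$ (permuting the order of $f_1,\dots,f_k$ changes the sign of $\gamma$ in (LR) by the signature of the permutation).
   Context: $\operatorname{Der}(R)$ is the $R$-module of derivations of $R$, i.e. additive maps $X:R\to R$ with $X(fg)=X(f)g+fX(g)$. $M^*=\operatorname{Hom}_R(M,R)$; for $f\in R$, the algebraic differential $df\in M^*$ is $df(X)=X(f)$. $\Lambda^qM^*$ is the $q$th exterior power (zero for $q<0$ or $q>m$, $R$ for $q=0$), whose elements are treated as skew-symmetric $q$-linear forms on $M$. $S$ is the multiplicative set of non-zero-divisors of $R$; $R_{fr}=S^{-1}R$, $M_{fr}=S^{-1}M$, $M_{fr}^*=S^{-1}M^*$; $R$, $M$, $M^*$ are canonically embedded in these. An element $\omega=\eta/c\in\Lambda^qM_{fr}^*$, $\eta\in\Lambda^qM^*$, $c\in S$, is called a meromorphic form with divisor $c$ if $c$ is not a unit and there is no other such representation of $\omega$ with invertible $c$. Forms $\eta/1$ with $\eta\in\Lambda^qM^*$ are called regular. If $c=f_1\cdots f_k$ with all $f_i\in R$ prime, the representation $\omega=\eta/(f_1\cdots f_k)$ is called reduced if there are no repeated (up to units) factors among $f_1,\dots,f_k$ and $\eta$ is not divisible by any $f_i$; then the divisor $f_1\cdots f_k$ is called reduced. A meromorphic form is reducible if it has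 a reduced representation. $\bar R=R/\mathcal I$, $\bar M=M/\mathcal IM$, $\bar M^*=M^*/\mathcal IM^*$, bars denoting classes; $\overline{df}_i:\bar M\to\bar R$ is $\overline{df}_i(v+\mathcal IM)=df_i(v)+\mathcal I$. $\bar R_{fr}$, $\bar M_{fr}$, $\bar M_{fr}^*$ are the localizations of $\bar R,\bar M,\bar M^*$ at the set of non-zero-divisors of $\bar R$, and $\ker\overline{df}_i$ in (iii) is taken in $\bar M_{fr}$. $I(df_1\wedge\cdots\wedge df_k)\subset R$ and $I(\overline{df}_1\wedge\cdots\wedge\overline{df}_k)\subset\bar R$ are the ideals generated by the coefficients of these $k$-forms in the bases of $\Lambda^kM^*$ and $\Lambda^k\bar M^*$ induced by a basis of $M^*$. For a commutative ring $A$, a sequence $a_1,\dots,a_q$ in $A$ is regular if $(a_1,\dots,a_q)\ne A$ and $a_i$ is a non-zero-divisor on $A/(a_1,\dots,a_{i-1})$ for all $i$. For a proper ideal $I$ of $A$, $\operatorname{depth} I$ is the supremum of lengths of regular sequences contained in $I$; $\operatorname{depth} A=\infty$.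
   Formalization: In (iii), equality of residues also assumes that some a in I(df_1∧…∧df_k) has ā a non-zero-divisor in R̄; without this it fails, e.g. R=Q[x,y], f_1=y, f_2=y−x², η=(f_1+f_2)dx∧dy, b=1, where both γ=0 and γ=x satisfy (LR). *)

(* Defs.v *)
From HB Require Import structures.
From mathcomp Require Import all_boot all_fingroup all_algebra.
From mathcomp Require Import ring boolp.

Set Implicit Arguments.
Unset Strict Implicit.
Unset Printing Implicit Defensive.

Import GRing.Theory.
Local Open Scope ring_scope.
Local Open Scope quotient_scope.

Section Elements.
Variable A : comNzRingType.
Implicit Types a b x y : A.

Definition nzd a : Prop := forall x, a * x = 0 -> x = 0.

Definition invertible a : Prop := exists b, a * b = 1.

Definition divides a b : Prop := exists c, b = a * c.

Definition associated a b : Prop := exists2 u, invertible u & a = u * b.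

Definition prime_elt a : Prop :=
  [/\ a <> 0, ~ invertible a &
      forall x y, divides a (x * y) -> divides a x \/ divides a y].

Definition irreducible_elt a : Prop :=
  [/\ a <> 0, ~ invertible a &
      forall x y, a = x * y -> invertible x \/ invertible y].

Definition is_domain : Prop := forall x y, x * y = 0 -> x = 0 \/ y = 0.

Definition is_ufd : Prop :=
  [/\ is_domain,
      forall a, a <> 0 -> ~ invertible a ->
        exists2 s : seq A, {in s, forall x, irreducible_elt x} &
                           a = \prod_(x <- s) x
    & forall s t : seq A,
        {in s, forall x, irreducible_elt x} ->
        {in t, forall x, irreducible_elt x} ->
        \prod_(x <- s) x = \prod_(x <- t) x ->
        exists t' : seq A, [/\ perm_eq t t', size s = size t' &
          forall i, (i < size s)%N -> associated s`_i t'`_i]].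

Definition in_gen (T : finType) (g : T -> A) x : Prop :=
  exists c : T -> A, x = \sum_t c t * g t.

Definition nzd_mod (J : A -> Prop) a : Prop := forall x, J (a * x) -> J x.

Definition regular_seq q (a : 'I_q -> A) : Prop :=
  ~ in_gen a 1 /\
  forall i : 'I_q,
    nzd_mod (in_gen (fun j : 'I_i => a (widen_ord (ltnW (ltn_ord i)) j))) (a i).

(* [depth_ge J d] is d <= depth J, where depth J is the supremum of the       *)
(* lengths of the regular sequences in J, and oo if J is the whole ring.      *)
Definition depth_ge (J : A -> Prop) (d : nat) : Prop :=
  J 1 \/ exists q (a : 'I_q -> A),
           [/\ regular_seq a, forall i, J (a i) & (d <= q)%N].

Definition is_basis (N : lmodType A) m (e : 'I_m -> N) : Prop :=
  forall x : N, exists! c : 'rV[A]_m, x = \sum_i c 0 i *: e i.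

End Elements.

Section Derivations.
Variable R : comNzRingType.

Record Der := MkDer {
  der_fun :> R -> R;
  derD : forall f g, der_fun (f + g) = der_fun f + der_fun g;
  derM : forall f g, der_fun (f * g) = der_fun f * g + f * der_fun g }.

HB.instance Definition _ := gen_eqMixin Der.
HB.instance Definition _ := gen_choiceMixin Der.

Lemma der_ext (X Y : Der) : X =1 Y -> X = Y.
Proof.
case: X Y => [X XD XM] [Y YD YM] /= /funext eXY; subst Y.
by congr MkDer; apply: Prop_irrelevance.
Qed.

Fact der0D (f g : R) : (0 : R) = 0 + 0. Proof. by rewrite addr0. Qed.
Fact der0M (f g : R) : (0 : R) = 0 * g + f * 0.
Proof. by rewrite mul0r mulr0 addr0. Qed.
Definition der0 : Der := @MkDer (fun=> 0) der0D der0M.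

Fact der_oppD (X : Der) f g : - X (f + g) = - X f + - X g.
Proof. by rewrite derD opprD. Qed.
Fact der_oppM (X : Der) f g : - X (f * g) = - X f * g + f * - X g.
Proof. by rewrite derM opprD mulNr mulrN. Qed.
Definition der_opp X : Der := MkDer (der_oppD X) (der_oppM X).

Fact der_addD (X Y : Der) f g :
  X (f + g) + Y (f + g) = (X f + Y f) + (X g + Y g).
Proof. by rewrite !derD addrACA. Qed.
Fact der_addM (X Y : Der) f g :
  X (f * g) + Y (f * g) = (X f + Y f) * g + f * (X g + Y g).
Proof. by rewrite !derM addrACA mulrDl mulrDr. Qed.
Definition der_add X Y : Der := MkDer (der_addD X Y) (der_addM X Y).

Fact der_scaleD a (X : Der) f g : a * X (f + g) = a * X f + a * X g.
Proof. by rewrite derD mulrDr. Qed.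
Fact der_scaleM a (X : Der) f g : a * X (f * g) = (a * X f) * g + f * (a * X g).
Proof. by rewrite derM mulrDr mulrA [f * (a * _)]mulrCA. Qed.
Definition der_scale a X : Der := MkDer (der_scaleD a X) (der_scaleM a X).

Fact der_addA : associative der_add.
Proof. by move=> X Y Z; apply: der_ext => f; apply: addrA. Qed.
Fact der_addC : commutative der_add.
Proof. by move=> X Y; apply: der_ext => f; apply: addrC. Qed.
Fact der_add0 : left_id der0 der_add.
Proof. by move=> X; apply: der_ext => f; apply: add0r. Qed.
Fact der_addN : left_inverse der0 der_opp der_add.
Proof. by move=> X; apply: der_ext => f; apply: addNr. Qed.
HB.instance Definition _ :=
  GRing.isZmodule.Build Der der_addA der_addC der_add0 der_addN.

Fact der_scaleA a b X : der_scale a (der_scale b X) = der_scale (a * b) X.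
Proof. by apply: der_ext => f; apply: mulrA. Qed.
Fact der_scale1 : left_id 1 der_scale.
Proof. by move=> X; apply: der_ext => f; apply: mul1r. Qed.
Fact der_scaleDr : right_distributive der_scale +%R.
Proof. by move=> a X Y; apply: der_ext => f; apply: mulrDr. Qed.
Fact der_scaleDl X : {morph der_scale^~ X : a b / a + b}.
Proof. by move=> a b; apply: der_ext => f; apply: mulrDl. Qed.
HB.instance Definition _ := GRing.Zmodule_isLmodule.Build R Der
  der_scaleA der_scale1 der_scaleDr der_scaleDl.

Definition differential (f : R) : Der -> R^o := fun X => X f.

Fact differential_linear f : linear (differential f).
Proof. by []. Qed.
HB.instance Definition _ f :=
  GRing.isLinear.Build R Der R^o *:%R (differential f) (differential_linear f).

End Derivations.

(* For a free module N of finite rank over A, the exterior power /\^q N^* is    *)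
(* the module of alternating q-linear forms on N. Over an arbitrary ring        *)
(* "skew-symmetric" has to mean "vanishing on repeated arguments".              *)
Section Forms.
Variables (A : comNzRingType) (N : lmodType A).

Definition subst_at q (v : 'I_q -> N) (i : 'I_q) (x : N) : 'I_q -> N :=
  fun j => if j == i then x else v j.

Record extform q := MkForm {
  form_fun :> ('I_q -> N) -> A;
  form_lin : forall v i a x y, form_fun (subst_at v i (a *: x + y)) =
    a * form_fun (subst_at v i x) + form_fun (subst_at v i y);
  form_alt : forall v i j, i != j -> v i = v j -> form_fun v = 0 }.

HB.instance Definition _ q := gen_eqMixin (extform q).
HB.instance Definition _ q := gen_choiceMixin (extform q).

Lemma form_ext q (w1 w2 : extform q) : w1 =1 w2 -> w1 = w2.
Proof.
case: w1 w2 => [w1 l1 a1] [w2 l2 a2] /= /funext e; subst w2.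
by congr MkForm; apply: Prop_irrelevance.
Qed.

Section Module.
Variable q : nat.

Fact form0_lin (v : 'I_q -> N) (i : 'I_q) (a : A) (x y : N) : 0 = a * 0 + 0 :> A.
Proof. by rewrite mulr0 addr0. Qed.
Definition form0 : extform q :=
  @MkForm q (fun=> 0) form0_lin (fun _ _ _ _ _ => erefl).

Fact form_opp_lin (w : extform q) v i a x y :
  - w (subst_at v i (a *: x + y)) = a * - w (subst_at v i x) + - w (subst_at v i y).
Proof. by rewrite form_lin opprD mulrN. Qed.
Fact form_opp_alt (w : extform q) v i j : i != j -> v i = v j -> - w v = 0.
Proof. by move=> ij e; rewrite (form_alt w ij e) oppr0. Qed.
Definition form_opp w : extform q := MkForm (form_opp_lin w) (@form_opp_alt w).

Fact form_add_lin (w1 w2 : extform q) v i a x y :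
  w1 (subst_at v i (a *: x + y)) + w2 (subst_at v i (a *: x + y)) =
  a * (w1 (subst_at v i x) + w2 (subst_at v i x)) +
  (w1 (subst_at v i y) + w2 (subst_at v i y)).
Proof. by rewrite !form_lin addrACA -mulrDr. Qed.
Fact form_add_alt (w1 w2 : extform q) v i j :
  i != j -> v i = v j -> w1 v + w2 v = 0.
Proof. by move=> ij e; rewrite !(form_alt _ ij e) addr0. Qed.
Definition form_add w1 w2 : extform q :=
  MkForm (form_add_lin w1 w2) (@form_add_alt w1 w2).

Fact form_scale_lin b (w : extform q) v i a x y :
  b * w (subst_at v i (a *: x + y)) =
  a * (b * w (subst_at v i x)) + b * w (subst_at v i y).
Proof. by rewrite form_lin mulrDr mulrCA. Qed.
Fact form_scale_alt b (w : extform q) v i j :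
  i != j -> v i = v j -> b * w v = 0.
Proof. by move=> ij e; rewrite (form_alt w ij e) mulr0. Qed.
Definition form_scale b w : extform q :=
  MkForm (form_scale_lin b w) (@form_scale_alt b w).

Fact form_addA : associative form_add.
Proof. by move=> X Y Z; apply: form_ext => f; apply: addrA. Qed.
Fact form_addC : commutative form_add.
Proof. by move=> X Y; apply: form_ext => f; apply: addrC. Qed.
Fact form_add0 : left_id form0 form_add.
Proof. by move=> X; apply: form_ext => f; apply: add0r. Qed.
Fact form_addN : left_inverse form0 form_opp form_add.
Proof. by move=> X; apply: form_ext => f; apply: addNr. Qed.
HB.instance Definition _ :=
  GRing.isZmodule.Build (extform q) form_addA form_addC form_add0 form_addN.

Fact form_scaleA a b X : form_scale a (form_scale b X) = form_scale (a * b) X.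
Proof. by apply: form_ext => f; apply: mulrA. Qed.
Fact form_scale1 : left_id 1 form_scale.
Proof. by move=> X; apply: form_ext => f; apply: mul1r. Qed.
Fact form_scaleDr : right_distributive form_scale +%R.
Proof. by move=> a X Y; apply: form_ext => f; apply: mulrDr. Qed.
Fact form_scaleDl X : {morph form_scale^~ X : a b / a + b}.
Proof. by move=> a b; apply: form_ext => f; apply: mulrDl. Qed.
HB.instance Definition _ := GRing.Zmodule_isLmodule.Build A (extform q)
  form_scaleA form_scale1 form_scaleDr form_scaleDl.

End Module.

Lemma subst_at_id q (v : 'I_q -> N) i : subst_at v i (v i) = v.
Proof. by apply: funext => j; rewrite /subst_at; case: eqP => // ->. Qed.

Lemma form_substD q (w : extform q) v i x y :
  w (subst_at v i (x + y)) = w (subst_at v i x) + w (subst_at v i y).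
Proof. by have := form_lin w v i 1 x y; rewrite scale1r mul1r. Qed.

Lemma form_subst0 q (w : extform q) v i : w (subst_at v i 0) = 0.
Proof.
have := form_substD w v i 0 0; rewrite addr0 => /eqP.
by rewrite addrC -subr_eq subrr eq_sym => /eqP.
Qed.

Lemma form_substZ q (w : extform q) v i a x :
  w (subst_at v i (a *: x)) = a * w (subst_at v i x).
Proof. by have := form_lin w v i a x 0; rewrite !addr0 form_subst0 addr0. Qed.

Lemma form_tperm q (w : extform q) (v : 'I_q -> N) i j : i != j ->
  w (v \o tperm i j) = - w v.
Proof.
move=> ij; pose u x y := subst_at (subst_at v i x) j y.
have uE x y k : u x y k = if k == j then y else if k == i then x else v k by [].
have ui x y : u x y i = x by rewrite uE (negPf ij) eqxx.
have uj x y : u x y j = y by rewrite uE eqxx.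
have uC x y : u x y = subst_at (subst_at v j y) i x.
  apply: funext => k; rewrite uE /subst_at.
  by case: (eqVneq k j) => [->|//]; rewrite eq_sym (negPf ij).
have uD x y x' y' :
    w (u (x + x') (y + y')) = w (u x y) + w (u x' y) + (w (u x y') + w (u x' y')).
  by rewrite /u form_substD -!/(u _ _) !uC !form_substD -!uC.
have ud x : w (u x x) = 0 by apply: (@form_alt _ w _ i j); rewrite // ui uj.
have := uD (v i) (v i) (v j) (v j).
rewrite !ud add0r addr0 => /esym/eqP; rewrite addr_eq0 => /eqP e.
have -> : v \o tperm i j = u (v j) (v i).
  apply: funext => k; rewrite uE /=.
  by case: tpermP => [->|->|/eqP/negPf -> /eqP/negPf ->]; rewrite ?eqxx ?(negPf ij).
have ev : u (v i) (v j) = v.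
  by apply: funext => k; rewrite uE; do 2?[case: eqP => [->//|_]].
by rewrite e ev.
Qed.

Lemma form_perm q (w : extform q) (s : 'S_q) (v : 'I_q -> N) :
  w (v \o s) = (-1) ^+ s * w v.
Proof.
have [ts -> dts] := prod_tpermP s; elim: ts dts v => [_|t ts IH /andP[dt dts]] v.
  rewrite big_nil odd_perm1 mul1r; congr (w _).
  by apply: funext => k; rewrite /= perm1.
rewrite big_cons odd_mul_tperm (dt : t.1 != t.2) signr_addb mulN1r.
pose s' := (\prod_(t <- ts) tperm t.1 t.2)%g.
have -> : v \o (tperm t.1 t.2 * s')%g = (v \o s') \o tperm t.1 t.2.
  by apply: funext => k; rewrite /= permM.
by rewrite form_tperm // IH // mulNr.
Qed.

Section Wedge.
Variables (q : nat) (theta : {linear N -> A^o}) (w : extform q).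

(* (theta /\ w)(v_0, ..., v_q) =                                              *)
(*   \sum_i (-1)^i theta(v_i) w(v_0, ..., v_i omitted, ..., v_q), so that     *)
(* theta_1 /\ ... /\ theta_k takes the value det (theta_i (v_j)).             *)
Definition wedge_fun (v : 'I_q.+1 -> N) : A :=
  \sum_(i < q.+1) (-1) ^+ i * (theta (v i) : A) * w (v \o lift i).

Fact wedge_lin v i a x y : wedge_fun (subst_at v i (a *: x + y)) =
  a * wedge_fun (subst_at v i x) + wedge_fun (subst_at v i y).
Proof.
rewrite /wedge_fun mulr_sumr -big_split; apply: eq_bigr => j _ /=.
have [ij|ne] := eqVneq j i; first subst i.
  have E z : subst_at v j z \o lift j = v \o lift j.
    apply: funext => l /=.
    by rewrite /subst_at eq_sym (negPf (neq_lift _ _)).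
  rewrite !E /subst_at eqxx linearP /=.
  by rewrite mulrDr mulrDl mulrCA !mulrA.
have [l El] : exists l, i = lift j l.
  by case: (unliftP j i) => [l ->|ij]; [exists l | rewrite ij eqxx in ne].
have E z : subst_at v i z \o lift j = subst_at (v \o lift j) l z.
  apply: funext => n /=.
  by rewrite /subst_at El (inj_eq (@lift_inj _ j)).
have F z : subst_at v i z j = v j by rewrite /subst_at (negPf ne).
by rewrite !E form_lin !F mulrDr mulrCA.
Qed.

Fact wedge_alt v i j : i != j -> v i = v j -> wedge_fun v = 0.
Proof.
move=> ij e; rewrite /wedge_fun (bigD1 i) //= (bigD1 j) ?(eq_sym j) //=.
rewrite big1 ?addr0 => [|n /andP[ni nj]]; last first.
  case: (unliftP n i) ni => [a Ea _|->]; last by rewrite eqxx.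
  case: (unliftP n j) nj => [b Eb _|->]; last by rewrite eqxx.
  rewrite (@form_alt _ w _ a b) ?mulr0 //=; last by rewrite -Ea -Eb.
  by apply: contraNneq ij => eab; rewrite Ea Eb eab.
pose t := tperm i j.
pose g (n : 'I_q) : 'I_q := odflt n (unlift j (t (lift i n))).
have gE (n : 'I_q) : lift j (g n) = t (lift i n).
  rewrite /g; case: unliftP => [m -> //|] tj.
  have : lift i n = i by apply: (@perm_inj _ t); rewrite tj /t tpermL.
  by move/eqP; rewrite eq_sym (negPf (neq_lift _ _)).
have g_inj : injective g.
  by move=> m n gmn; apply: (@lift_inj _ i); apply: (@perm_inj _ t); rewrite -!gE gmn.
pose s := perm g_inj.
have ts : t = lift_perm i j s.
  apply/permP => n; case: (unliftP i n) => [m ->|->].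
    by rewrite lift_perm_lift [s m]permE gE.
  by rewrite lift_perm_id /t tpermL.
have ods : odd i (+) odd j (+) s = true.
  by rewrite -odd_lift_perm -ts odd_tperm ij.
have -> : v \o lift i = (v \o lift j) \o s.
  apply: funext => n; rewrite /= [s n]permE gE /t.
  by case: tpermP => [->|->|//].
rewrite form_perm e mulrA [_ * _ * (-1) ^+ s]mulrAC.
have -> : (-1) ^+ i * (-1) ^+ s = - (-1) ^+ j :> A.
  rewrite -[(-1) ^+ i]signr_odd -[(-1) ^+ j]signr_odd -signr_addb.
  by case: (s : bool) (odd i) (odd j) ods => [] [] [] //= _; rewrite ?expr0 ?expr1 ?opprK.
by rewrite !mulNr addNr.
Qed.

Definition wedge : extform q.+1 := MkForm wedge_lin wedge_alt.

End Wedge.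

Fact const_form_lin (c : A) (v : 'I_0 -> N) (i : 'I_0) (a : A) (x y : N) :
  c = a * c + c.
Proof. by case: i. Qed.
Fact const_form_alt (c : A) (v : 'I_0 -> N) (i j : 'I_0) :
  i != j -> v i = v j -> c = 0.
Proof. by case: i. Qed.
Definition const_form c : extform 0 :=
  MkForm (@const_form_lin c) (@const_form_alt c).

(* wedges theta w = theta_1 /\ ... /\ theta_k /\ w *)
Fixpoint wedges k q : ('I_k -> {linear N -> A^o}) -> extform q -> extform (k + q) :=
  match k with
  | 0 => fun _ w => w
  | k'.+1 => fun theta w =>
      wedge (theta ord0) (wedges (fun i => theta (lift ord0 i)) w)
  end.

Definition cast_form q q' (e : q = q') (w : extform q) : extform q' :=
  ecast n (extform n) e w.

(* The ideal generated by the coefficients of w in the basis of /\^q N^*      *)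
(* induced by the basis of N^* dual to e.                                     *)
Definition coef_ideal m (e : 'I_m -> N) q (w : extform q) : A -> Prop :=
  in_gen (fun s : {s : {ffun 'I_q -> 'I_m} |
                    [forall i : 'I_q, forall j : 'I_q, (i < j)%N ==> (s i < s j)%N]} =>
            w (fun i => e (val s i))).

End Forms.

Section Denominators.
Variable A : comNzRingType.

Record nonzerodiv := NonZeroDiv { nzd_val :> A; nzdP : nzd nzd_val }.

HB.instance Definition _ := gen_eqMixin nonzerodiv.
HB.instance Definition _ := gen_choiceMixin nonzerodiv.

Lemma nzd1 : nzd (1 : A).
Proof. by move=> x; rewrite mul1r. Qed.

Lemma nzdM (s t : A) : nzd s -> nzd t -> nzd (s * t).
Proof. by move=> hs ht x; rewrite -mulrA => /hs/ht. Qed.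

Definition one_nzd : nonzerodiv := NonZeroDiv nzd1.
Definition mul_nzd (s t : nonzerodiv) : nonzerodiv :=
  NonZeroDiv (nzdM (@nzdP s) (@nzdP t)).

Lemma nonzerodiv_inj (s t : nonzerodiv) : s = t :> A -> s = t.
Proof.
case: s t => [s hs] [t ht] /= e; subst t.
by congr NonZeroDiv; apply: Prop_irrelevance.
Qed.

End Denominators.

Section Localization.
Variables (A : comNzRingType) (N : lmodType A).
Local Notation S := (nonzerodiv A).
Implicit Types (x y z : N) (r s t u : S).

Definition loc_equiv (p p' : N * S) : bool :=
  `[< exists u : S, ((u : A) * (p'.2 : A)) *: p.1 = ((u : A) * (p.2 : A)) *: p'.1 >].

Lemma loc_equiv_is_equiv : equiv_class_of loc_equiv.
Proof.
split=> [[x s]|[x s] [y t]|[y t] [x s] [z r]]; rewrite /loc_equiv /=.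
- by apply/asboolP; exists (one_nzd A).
- by apply/idP/idP => /asboolP[u e]; apply/asboolP; exists u.
move=> /asboolP[u /= eu] /asboolP[v /= ev]; apply/asboolP.
exists (mul_nzd (mul_nzd u v) t) => /=.
transitivity (((u : A) * (s : A)) *: (((v : A) * (r : A)) *: y)).
  transitivity (((v : A) * (r : A)) *: (((u : A) * (t : A)) *: x)).
    by rewrite scalerA; congr (_ *: _); ring.
  by rewrite eu !scalerA; congr (_ *: _); ring.
by rewrite ev scalerA; congr (_ *: _); ring.
Qed.

Canonical loc_equiv_equiv := EquivRelPack loc_equiv_is_equiv.
Canonical loc_equiv_encModRel := defaultEncModRel loc_equiv.

Definition localized := {eq_quot loc_equiv}.
HB.instance Definition _ := Choice.on localized.
HB.instance Definition _ := EqQuotient.on localized.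

Definition mkloc x s : localized := \pi_localized (x, s).
Definition lnum (a : localized) : N := (generic_quotient.repr a).1.
Definition lden (a : localized) : S := (generic_quotient.repr a).2.

Lemma mkloc_eqP x s y t :
  mkloc x s = mkloc y t <-> exists u : S, ((u : A) * (t : A)) *: x = ((u : A) * (s : A)) *: y.
Proof.
split=> [/eqP|e]; first by rewrite eqmodE => /asboolP.
by apply/eqP; rewrite eqmodE; apply/asboolP.
Qed.

Lemma mkloc_numden a : mkloc (lnum a) (lden a) = a.
Proof. by rewrite /mkloc /lnum /lden -surjective_pairing reprK. Qed.

Lemma numden_mkloc x s : exists u : S,
  ((u : A) * (s : A)) *: lnum (mkloc x s) = ((u : A) * (lden (mkloc x s) : A)) *: x.
Proof. by apply/mkloc_eqP; rewrite mkloc_numden. Qed.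

Lemma mkloc_cancel x s t : mkloc ((t : A) *: x) (mul_nzd t s) = mkloc x s.
Proof.
apply/mkloc_eqP; exists (one_nzd A) => /=.
by rewrite !mul1r scalerA mulrC.
Qed.

Definition loc_embed x : localized := mkloc x (one_nzd A).

Definition loc_opp (a : localized) := mkloc (- lnum a) (lden a).
Definition loc_add (a b : localized) :=
  mkloc ((lden b : A) *: lnum a + (lden a : A) *: lnum b)
        (mul_nzd (lden a) (lden b)).

Lemma loc_oppE x s : loc_opp (mkloc x s) = mkloc (- x) s.
Proof.
have [u e] := numden_mkloc x s.
by apply/mkloc_eqP; exists u; rewrite !scalerN e.
Qed.

Lemma loc_addE x s y t :
  loc_add (mkloc x s) (mkloc y t) =
  mkloc ((t : A) *: x + (s : A) *: y) (mul_nzd s t).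
Proof.
have [u eu] := numden_mkloc x s; have [v ev] := numden_mkloc y t.
rewrite /loc_add; move: (lnum _) (lden _) eu (lnum _) (lden _) ev => x' s' eu y' t' ev.
apply/mkloc_eqP; exists (mul_nzd u v) => /=; rewrite !scalerDr !scalerA.
congr (_ + _).
  rewrite (_ : _ * _ = ((v : A) * (t : A) * (t' : A)) * ((u : A) * (s : A))); last by ring.
  by rewrite -scalerA eu scalerA; congr (_ *: _); ring.
rewrite (_ : _ * _ = ((u : A) * (s : A) * (s' : A)) * ((v : A) * (t : A))); last by ring.
by rewrite -scalerA ev scalerA; congr (_ *: _); ring.
Qed.

Lemma loc_ind (P : localized -> Prop) : (forall x s, P (mkloc x s)) -> forall a, P a.
Proof. by move=> h a; rewrite -(mkloc_numden a). Qed.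

Fact loc_addA : associative loc_add.
Proof.
elim/loc_ind=> x s; elim/loc_ind=> y t; elim/loc_ind=> z r.
rewrite !loc_addE; congr mkloc; last by apply: nonzerodiv_inj; rewrite /= mulrA.
rewrite !scalerDr !scalerA addrA /=; congr (_ *: _ + _ *: _ + _ *: _); ring.
Qed.
Fact loc_addC : commutative loc_add.
Proof.
elim/loc_ind=> x s; elim/loc_ind=> y t; rewrite !loc_addE addrC.
by congr mkloc; apply: nonzerodiv_inj; rewrite /= mulrC.
Qed.
Fact loc_add0 : left_id (loc_embed 0) loc_add.
Proof.
elim/loc_ind=> x s; rewrite loc_addE scaler0 add0r scale1r.
by congr mkloc; apply: nonzerodiv_inj; rewrite /= mul1r.
Qed.
Fact loc_addN : left_inverse (loc_embed 0) loc_opp loc_add.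
Proof.
elim/loc_ind=> x s; rewrite loc_oppE loc_addE scalerN addNr.
by apply/mkloc_eqP; exists (one_nzd A); rewrite !scaler0.
Qed.
HB.instance Definition _ :=
  GRing.isZmodule.Build localized loc_addA loc_addC loc_add0 loc_addN.

Lemma mklocD x s y t :
  mkloc x s + mkloc y t = mkloc ((t : A) *: x + (s : A) *: y) (mul_nzd s t).
Proof. exact: loc_addE. Qed.

Lemma mklocDl x y s : mkloc x s + mkloc y s = mkloc (x + y) s.
Proof. by rewrite mklocD -scalerDr mkloc_cancel. Qed.

End Localization.

Arguments mkloc {A N} x s.
Arguments lnum {A N} a.
Arguments lden {A N} a.
Arguments loc_embed {A N} x.

Section FractionRing.
Variable A : comNzRingType.
Local Notation S := (nonzerodiv A).
Implicit Types (x y z : A) (r s t : S).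

Definition fracring : Type := localized (A^o : lmodType A).
HB.instance Definition _ := GRing.Zmodule.on fracring.

Definition mkfrac x s : fracring := mkloc (x : A^o) s.

Lemma mkfrac_eqP x s y t : mkfrac x s = mkfrac y t <-> x * (t : A) = y * (s : A).
Proof.
split=> [/mkloc_eqP[u /= e]|e]; last first.
  apply/mkloc_eqP; exists (one_nzd A) => /=.
  by rewrite !mul1r [_ *: _]mulrC e [RHS]mulrC.
apply: subr0_eq; apply: (@nzdP _ u); rewrite mulrBr; apply/eqP; rewrite subr_eq0.
by apply/eqP; rewrite [x * _]mulrC [y * _]mulrC !mulrA.
Qed.

Lemma frac_ind (P : fracring -> Prop) : (forall x s, P (mkfrac x s)) -> forall a, P a.
Proof. by move=> h a; rewrite -(mkloc_numden a); apply: h. Qed.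

Definition frac_mul (a b : fracring) : fracring :=
  mkfrac ((lnum a : A) * lnum b) (mul_nzd (lden a) (lden b)).

Lemma mkfrac_numden (a : fracring) : mkfrac (lnum a) (lden a) = a.
Proof. exact: mkloc_numden. Qed.

Lemma frac_mulE x s y t :
  frac_mul (mkfrac x s) (mkfrac y t) = mkfrac (x * y) (mul_nzd s t).
Proof.
have /mkfrac_eqP := mkfrac_numden (mkfrac x s).
have /mkfrac_eqP := mkfrac_numden (mkfrac y t).
rewrite /frac_mul; move: (lnum (mkfrac x s)) (lden (mkfrac x s)) => x' s'.
move: (lnum (mkfrac y t)) (lden (mkfrac y t)) => y' t' ey ex.
by apply/mkfrac_eqP; rewrite /= mulrACA ex ey mulrACA.
Qed.

Fact frac_mulA : associative frac_mul.
Proof.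
elim/frac_ind=> x s; elim/frac_ind=> y t; elim/frac_ind=> z r.
by rewrite !frac_mulE; apply/mkfrac_eqP => /=; ring.
Qed.
Fact frac_mulC : commutative frac_mul.
Proof.
elim/frac_ind=> x s; elim/frac_ind=> y t.
by rewrite !frac_mulE; apply/mkfrac_eqP => /=; ring.
Qed.
Fact frac_mul1 : left_id (mkfrac 1 (one_nzd A)) frac_mul.
Proof.
by elim/frac_ind=> x s; rewrite !frac_mulE; apply/mkfrac_eqP => /=; ring.
Qed.
Lemma mkfracD x s y t :
  mkfrac x s + mkfrac y t = mkfrac (x * (t : A) + y * (s : A)) (mul_nzd s t).
Proof. by rewrite [x * _]mulrC [y * _]mulrC; apply: mklocD. Qed.
Fact frac_mulDl : left_distributive frac_mul +%R.
Proof.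
elim/frac_ind=> x s; elim/frac_ind=> y t; elim/frac_ind=> z r.
by rewrite !(mkfracD, frac_mulE); apply/mkfrac_eqP => /=; ring.
Qed.
Fact frac_nonzero1 : mkfrac 1 (one_nzd A) != 0 :> fracring.
Proof.
by apply/eqP => /mkfrac_eqP /eqP; rewrite /= !mulr1 oner_eq0.
Qed.
HB.instance Definition _ := GRing.Zmodule_isComNzRing.Build fracring
  frac_mulA frac_mulC frac_mul1 frac_mulDl frac_nonzero1.

Lemma mkfracM x s y t : mkfrac x s * mkfrac y t = mkfrac (x * y) (mul_nzd s t).
Proof. exact: frac_mulE. Qed.

Definition frac_unit : pred fracring := fun a => `[< nzd (lnum a : A) >].
Definition frac_inv (a : fracring) : fracring :=
  if pselect (nzd (lnum a : A)) is left h then mkfrac (lden a) (NonZeroDiv h)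
  else a.

Fact frac_mulV : {in frac_unit, left_inverse 1 frac_inv *%R}.
Proof.
move=> a /asboolP ha; rewrite /frac_inv; case: pselect => // h.
by rewrite -[X in _ * X]mkfrac_numden mkfracM; apply/mkfrac_eqP => /=; ring.
Qed.
Fact frac_unitP (a b : fracring) : b * a = 1 -> frac_unit a.
Proof.
rewrite -(mkfrac_numden b) -[X in _ * X]mkfrac_numden mkfracM => /mkfrac_eqP /=.
rewrite mulr1 mul1r => e; apply/asboolP => x ax0.
apply: (@nzdP _ (lden a)); apply: (@nzdP _ (lden b)).
by rewrite mulrA -e -mulrA ax0 mulr0.
Qed.
Fact frac_inv_out : {in [predC frac_unit], frac_inv =1 id}.
Proof.
move=> a /negP ha; rewrite /frac_inv; case: pselect => // h.
by case: ha; apply/asboolP.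
Qed.
HB.instance Definition _ := GRing.ComNzRing_hasMulInverse.Build fracring
  frac_mulV frac_unitP frac_inv_out.

Definition frac_embed x : fracring := mkfrac x (one_nzd A).

Fact frac_embed_zmod : zmod_morphism frac_embed.
Proof.
move=> x y; apply/eqP; rewrite eq_sym subr_eq; apply/eqP.
by rewrite mkfracD; apply/mkfrac_eqP => /=; ring.
Qed.
HB.instance Definition _ :=
  GRing.isZmodMorphism.Build A fracring frac_embed frac_embed_zmod.
Fact frac_embed_monoid : monoid_morphism frac_embed.
Proof. by split=> // x y; rewrite mkfracM; apply/mkfrac_eqP => /=; ring. Qed.
HB.instance Definition _ :=
  GRing.isMonoidMorphism.Build A fracring frac_embed frac_embed_monoid.

Lemma frac_embed_unit x : nzd x -> frac_embed x \is a GRing.unit.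
Proof.
move=> hx; apply/unitrP; exists (mkfrac 1 (NonZeroDiv hx)); rewrite mulrC.
by split; rewrite mkfracM; apply/mkfrac_eqP => /=; ring.
Qed.

Lemma mkfracE x s : mkfrac x s = frac_embed x / frac_embed s.
Proof.
apply: (canRL (mulrK (frac_embed_unit (@nzdP _ s)))).
by rewrite mkfracM; apply/mkfrac_eqP => /=; ring.
Qed.

End FractionRing.

Section LocalizedModule.
Variables (A : comNzRingType) (N : lmodType A).
Local Notation S := (nonzerodiv A).

Definition loc_scale (a : fracring A) (b : localized N) : localized N :=
  mkloc ((lnum a : A) *: lnum b) (mul_nzd (lden a) (lden b)).

Lemma loc_scaleE (x : A) s (y : N) t :
  loc_scale (mkfrac x s) (mkloc y t) = mkloc (x *: y) (mul_nzd s t).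
Proof.
have /mkfrac_eqP := mkfrac_numden (mkfrac x s).
have [v] := numden_mkloc y t.
rewrite /loc_scale; move: (lnum (mkfrac x s)) (lden (mkfrac x s)) => x' s'.
move: (lnum (mkloc y t)) (lden (mkloc y t)) => y' t' ey ex.
apply/mkloc_eqP; exists v; rewrite /= !scalerA.
transitivity ((x' * (s : A)) *: (((v : A) * (t : A)) *: y')).
  by rewrite scalerA; congr (_ *: _); ring.
by rewrite ey scalerA ex; congr (_ *: _); ring.
Qed.

Fact loc_scaleA a b (c : localized N) :
  loc_scale a (loc_scale b c) = loc_scale (a * b) c.
Proof.
elim/frac_ind: a => x s; elim/frac_ind: b => y t; elim/loc_ind: c => z r.
rewrite mkfracM !loc_scaleE scalerA.
by congr mkloc; apply: nonzerodiv_inj; rewrite /= mulrA.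
Qed.
Fact loc_scale1 : left_id 1 loc_scale.
Proof.
elim/loc_ind=> x s; rewrite loc_scaleE scale1r.
by congr mkloc; apply: nonzerodiv_inj; rewrite /= mul1r.
Qed.
Fact loc_scaleDr : right_distributive loc_scale +%R.
Proof.
elim/frac_ind=> x s; elim/loc_ind=> y t; elim/loc_ind=> z r.
rewrite !(mklocD, loc_scaleE) !scalerDr !scalerA /=.
rewrite -[LHS](mkloc_cancel _ _ s) scalerDr !scalerA.
congr mkloc; last by apply: nonzerodiv_inj => /=; ring.
by congr (_ *: _ + _ *: _); ring.
Qed.
Fact loc_scaleDl c : {morph loc_scale^~ c : a b / a + b}.
Proof.
elim/frac_ind=> x s; elim/frac_ind=> y t; elim/loc_ind: c => z r.
rewrite mkfracD !loc_scaleE mklocD !scalerA /= -scalerDl.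
rewrite -[LHS](mkloc_cancel _ _ r) scalerA.
congr mkloc; last by apply: nonzerodiv_inj => /=; ring.
by congr (_ *: _); ring.
Qed.
HB.instance Definition _ := GRing.Zmodule_isLmodule.Build (fracring A) (localized N)
  loc_scaleA loc_scale1 loc_scaleDr loc_scaleDl.

Lemma mklocZ (x : A) s (y : N) t :
  mkfrac x s *: mkloc y t = mkloc (x *: y) (mul_nzd s t).
Proof. exact: loc_scaleE. Qed.

End LocalizedModule.

Section LocalizedForms.
Variables (A : comNzRingType) (N : lmodType A).
Local Notation S := (nonzerodiv A).

Lemma form_scale_all q (w : extform N q) (c : 'I_q -> A) (x : 'I_q -> N) :
  w (fun i => c i *: x i) = (\prod_i c i) * w x.
Proof.
pose X (r : seq 'I_q) i := if i \in r then c i *: x i else x i.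
suff H (r : seq 'I_q) : uniq r -> w (X r) = (\prod_(i <- r) c i) * w x.
  rewrite -H ?index_enum_uniq //; congr (w _); apply: funext => i.
  by rewrite /X mem_index_enum.
elim: r => [_|i r IH /= /andP[ir ur]]; first by rewrite big_nil mul1r.
have -> : X (i :: r) = subst_at (X r) i (c i *: x i).
  apply: funext => j; rewrite /X /subst_at inE.
  by case: eqP => [->|_].
rewrite form_substZ big_cons -mulrA -IH //; congr (_ * w _).
by apply: funext => j; rewrite /X /subst_at; case: eqP => [->|//]; rewrite (negPf ir).
Qed.

Definition prod_nzd q (s : 'I_q -> S) : S := \big[@mul_nzd A/one_nzd A]_i s i.

Lemma prod_nzdE q (s : 'I_q -> S) : prod_nzd s = \prod_i (s i : A) :> A.
Proof. exact: (big_morph (@nzd_val A) (fun _ _ => erefl) erefl). Qed.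

Definition loc_form_fun q (w : extform N q) (v : 'I_q -> localized N) : fracring A :=
  mkfrac (w (fun i => lnum (v i))) (prod_nzd (fun i => lden (v i))).

Lemma loc_form_funE q (w : extform N q) (x : 'I_q -> N) (s : 'I_q -> S) :
  loc_form_fun w (fun i => mkloc (x i) (s i)) = mkfrac (w x) (prod_nzd s).
Proof.
rewrite /loc_form_fun; apply/mkfrac_eqP; rewrite !prod_nzdE.
have [u hu] := choice (fun i => numden_mkloc (x i) (s i)).
apply: subr0_eq; apply: (@nzdP _ (prod_nzd u)); rewrite mulrBr.
apply/eqP; rewrite subr_eq0 prod_nzdE; apply/eqP.
rewrite ![w _ * _]mulrC !mulrA -!big_split /= -!form_scale_all.
by congr (w _); apply: funext => i; rewrite hu.
Qed.

Lemma loc_form_subst q (w : extform N q) (x : 'I_q -> N) (s : 'I_q -> S) i y t :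
  loc_form_fun w (subst_at (fun i => mkloc (x i) (s i)) i (mkloc y t)) =
  mkfrac (w (subst_at x i y)) (mul_nzd t (\big[@mul_nzd A/one_nzd A]_(j | j != i) s j)).
Proof.
pose s' j := if j == i then t else s j.
have -> : subst_at (fun i => mkloc (x i) (s i)) i (mkloc y t) =
          fun j => mkloc (subst_at x i y j) (s' j).
  by apply: funext => j; rewrite /subst_at /s'; case: eqP.
rewrite loc_form_funE; congr mkfrac; apply: nonzerodiv_inj.
rewrite prod_nzdE (bigD1 i) //= /s' eqxx; congr (_ * _).
rewrite (big_morph (@nzd_val A) (fun _ _ => erefl) erefl).
by apply: eq_bigr => j /negPf ->.
Qed.

Fact loc_form_lin q (w : extform N q) v i a x y :
  loc_form_fun w (subst_at v i (a *: x + y)) =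
  a * loc_form_fun w (subst_at v i x) + loc_form_fun w (subst_at v i y).
Proof.
have -> : v = fun i => mkloc (lnum (v i)) (lden (v i)).
  by apply: funext => j; rewrite mkloc_numden.
elim/frac_ind: a => a b; elim/loc_ind: x => x s; elim/loc_ind: y => y t.
rewrite mklocZ mklocD !loc_form_subst form_lin form_substZ form_substZ.
rewrite mkfracM mkfracD.
by apply/mkfrac_eqP => /=; ring.
Qed.

Fact loc_form_alt q (w : extform N q) v i j :
  i != j -> v i = v j -> loc_form_fun w v = 0.
Proof.
move=> ij e; rewrite /loc_form_fun (@form_alt _ _ _ w _ i j) // ?e //.
by apply/mkfrac_eqP; rewrite !mul0r.
Qed.

Definition loc_form q (w : extform N q) : extform (localized N) q :=
  MkForm (loc_form_lin w) (@loc_form_alt q w).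

Definition loc_lin_fun (theta : {linear N -> A^o}) (x : localized N) :
  (fracring A)^o := mkfrac (theta (lnum x) : A) (lden x).

Lemma loc_lin_funE (theta : {linear N -> A^o}) x s :
  loc_lin_fun theta (mkloc x s) = mkfrac (theta x : A) s.
Proof.
have [u e] := numden_mkloc x s; apply/mkfrac_eqP.
apply: subr0_eq; apply: (@nzdP _ u); rewrite mulrBr.
apply/eqP; rewrite subr_eq0 ![theta _ * _]mulrC !mulrA.
by apply/eqP; have := congr1 theta e; rewrite !linearZ.
Qed.

Fact loc_lin_linear (theta : {linear N -> A^o}) : linear (loc_lin_fun theta).
Proof.
elim/frac_ind=> a b; elim/loc_ind=> x s; elim/loc_ind=> y t.
rewrite mklocZ mklocD !loc_lin_funE.
rewrite -[RHS]/(mkfrac a b * mkfrac (theta x : A) s + mkfrac (theta y : A) t).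
rewrite mkfracM mkfracD linearD !linearZ.
by apply/mkfrac_eqP => /=; rewrite /GRing.scale /=; ring.
Qed.
HB.instance Definition _ (theta : {linear N -> A^o}) :=
  GRing.isLinear.Build (fracring A) (localized N) (fracring A)^o *:%R
    (loc_lin_fun theta) (loc_lin_linear theta).

Definition loc_lin theta : {linear localized N -> (fracring A)^o} :=
  loc_lin_fun theta.

End LocalizedForms.

Section QuotientModule.
Variables (A : comNzRingType) (I : idealr A) (N : lmodType A).
Local Notation B := {ideal_quot I}.

Definition ideal_mul (y : N) : bool :=
  `[< exists n (a : 'I_n -> A) (x : 'I_n -> N),
        (forall i, a i \in (I : {pred A})) /\ y = \sum_i a i *: x i >].

Fact ideal_mul_closed : zmod_closed ideal_mul.
Proof.
split=> [|x y].
  by apply/asboolP; exists 0, (fun=> 0), (fun=> 0); split=> [[]//|]; rewrite big_ord0.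
rewrite /in_mem /= => /asboolP[n [a [u [ha ->]]]] /asboolP[p [b [v [hb ->]]]].
apply/asboolP; exists (n + p)%N.
exists (fun i => match split i with inl j => a j | inr j => - b j end).
exists (fun i => match split i with inl j => u j | inr j => v j end).
split=> [i|]; first by case: split => j //; rewrite rpredN.
rewrite big_split_ord /= -sumrN; congr (_ + _); apply: eq_bigr => j _.
  by rewrite (unsplitK (inl j)).
by rewrite (unsplitK (inr j)) scaleNr.
Qed.
HB.instance Definition _ := GRing.isZmodClosed.Build N ideal_mul ideal_mul_closed.
Definition ideal_mul_zmod : zmodClosed N := GRing.ZmodClosed.clone N ideal_mul _.

Lemma ideal_mulZ (a : A) (x : N) : a \in (I : {pred A}) -> a *: x \in ideal_mul.
Proof.
move=> ha; apply/asboolP; exists 1, (fun=> a), (fun=> x).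
by rewrite big_ord1.
Qed.

Lemma ideal_mulZr (a : A) (x : N) : x \in ideal_mul -> a *: x \in ideal_mul.
Proof.
move=> /asboolP[n [b [u [hb ->]]]]; apply/asboolP; exists n.
exists (fun i => a * b i), u; split=> [i|]; first exact: idealMr.
by rewrite scaler_sumr; apply: eq_bigr => i _; rewrite scalerA.
Qed.

Definition quotmod : Type := @Quotient.quot N ideal_mul_zmod.
HB.instance Definition _ := GRing.Zmodule.on quotmod.

Definition mkquot (x : N) : quotmod := \pi_(@Quotient.quot N ideal_mul_zmod) x.
Definition mkres (a : A) : B := \pi_B a.

Lemma mkquot_eqP x y : mkquot x = mkquot y <-> x - y \in ideal_mul.
Proof.
rewrite Quotient.idealrBE.
by split=> [/eqP|/eqP].
Qed.

Lemma mkres_eqP a b : mkres a = mkres b <-> a - b \in (I : {pred A}).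
Proof. by rewrite Quotient.idealrBE; split=> [/eqP|/eqP]. Qed.

Lemma mkquotD x y : mkquot (x + y) = mkquot x + mkquot y.
Proof. exact: Quotient.pi_add. Qed.
Lemma mkresD a b : mkres (a + b) = mkres a + mkres b.
Proof. exact: rmorphD. Qed.
Lemma mkresM a b : mkres (a * b) = mkres a * mkres b.
Proof. exact: rmorphM. Qed.
Lemma mkres1 : mkres 1 = 1.
Proof. exact: rmorph1. Qed.

Definition qrep (x : quotmod) : N := generic_quotient.repr (x : @Quotient.quot N ideal_mul_zmod).
Definition rrep (a : B) : A := generic_quotient.repr a.

Lemma qrepK x : mkquot (qrep x) = x. Proof. exact: reprK. Qed.
Lemma rrepK a : mkres (rrep a) = a. Proof. exact: reprK. Qed.

Lemma quot_ind (P : quotmod -> Prop) : (forall x, P (mkquot x)) -> forall a, P a.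
Proof. by move=> h a; rewrite -(qrepK a). Qed.
Lemma res_ind (P : B -> Prop) : (forall x, P (mkres x)) -> forall a, P a.
Proof. by move=> h a; rewrite -(rrepK a). Qed.

Definition quot_scale (a : B) (x : quotmod) : quotmod := mkquot (rrep a *: qrep x).

Lemma quot_scaleE a x : quot_scale (mkres a) (mkquot x) = mkquot (a *: x).
Proof.
have /mkres_eqP ha := rrepK (mkres a); have /mkquot_eqP hx := qrepK (mkquot x).
apply/mkquot_eqP; rewrite (_ : _ - _ =
  rrep (mkres a) *: (qrep (mkquot x) - x) + (rrep (mkres a) - a) *: x).
  by apply: rpredD; [apply: ideal_mulZr | apply: ideal_mulZ].
by rewrite scalerBr scalerBl addrA subrK.
Qed.

Fact quot_scaleA a b x : quot_scale a (quot_scale b x) = quot_scale (a * b) x.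
Proof.
elim/res_ind: a => a; elim/res_ind: b => b; elim/quot_ind: x => x.
by rewrite -mkresM !quot_scaleE scalerA.
Qed.
Fact quot_scale1 : left_id 1 quot_scale.
Proof. by elim/quot_ind=> x; rewrite -mkres1 quot_scaleE scale1r. Qed.
Fact quot_scaleDr : right_distributive quot_scale +%R.
Proof.
elim/res_ind=> a; elim/quot_ind=> x; elim/quot_ind=> y.
by rewrite -mkquotD !quot_scaleE -mkquotD scalerDr.
Qed.
Fact quot_scaleDl x : {morph quot_scale^~ x : a b / a + b}.
Proof.
elim/res_ind=> a; elim/res_ind=> b; elim/quot_ind: x => x.
by rewrite -mkresD !quot_scaleE -mkquotD scalerDl.
Qed.
HB.instance Definition _ := GRing.Zmodule_isLmodule.Build B quotmod
  quot_scaleA quot_scale1 quot_scaleDr quot_scaleDl.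

Lemma mkquotZ a x : mkquot (a *: x) = mkres a *: mkquot x.
Proof. by rewrite -quot_scaleE. Qed.

Definition quot_lin_fun (theta : {linear N -> A^o}) (x : quotmod) : B^o :=
  mkres (theta (qrep x)).

Lemma quot_lin_funE (theta : {linear N -> A^o}) x :
  quot_lin_fun theta (mkquot x) = mkres (theta x).
Proof.
have /mkquot_eqP/asboolP[n [a [u [ha e]]]] := qrepK (mkquot x).
apply/mkres_eqP; rewrite -linearB e linear_sum /=; apply: rpred_sum => i _.
by rewrite linearZ /= [_ *: _]mulrC idealMr.
Qed.

Fact quot_lin_linear theta : linear (quot_lin_fun theta).
Proof.
elim/res_ind=> a; elim/quot_ind=> x; elim/quot_ind=> y.
by rewrite -mkquotZ -mkquotD !quot_lin_funE linearP mkresD mkresM.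
Qed.
HB.instance Definition _ (theta : {linear N -> A^o}) :=
  GRing.isLinear.Build B quotmod B^o *:%R
    (quot_lin_fun theta) (quot_lin_linear theta).

Definition quot_lin theta : {linear quotmod -> B^o} := quot_lin_fun theta.

Lemma form_subst_res q (w : extform N q) v i x y :
  mkquot x = mkquot y -> mkres (w (subst_at v i x)) = mkres (w (subst_at v i y)).
Proof.
move=> /mkquot_eqP/asboolP[n [a [u [ha e]]]].
rewrite -[x](subrK y) e form_substD mkresD -[RHS]add0r; congr (_ + _).
suff H m (b : 'I_m -> A) (z : 'I_m -> N) : (forall i, b i \in (I : {pred A})) ->
    w (subst_at v i (\sum_j b j *: z j)) \in (I : {pred A}).
  have -> : 0 = mkres 0 by rewrite /mkres rmorph0.
  by apply/mkres_eqP; rewrite subr0 H.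
elim: m b z => [|m IH] b z hb; first by rewrite big_ord0 form_subst0 rpred0.
rewrite big_ord_recl form_substD rpredD ?IH //.
by rewrite form_substZ mulrC idealMr.
Qed.

Lemma form_res q (w : extform N q) (x y : 'I_q -> N) :
  (forall i, mkquot (x i) = mkquot (y i)) -> mkres (w x) = mkres (w y).
Proof.
move=> e; pose X (r : seq 'I_q) i := if i \in r then x i else y i.
suff H (r : seq 'I_q) : mkres (w (X r)) = mkres (w y).
  rewrite -(H (index_enum 'I_q)); congr (mkres (w _)); apply: funext => i.
  by rewrite /X mem_index_enum.
elim: r => [//|i r <-].
have -> : X (i :: r) = subst_at (X r) i (x i).
  by apply: funext => j; rewrite /X /subst_at inE; case: eqP => [->|_].
rewrite -[in RHS](subst_at_id (X r) i); apply: form_subst_res.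
by rewrite /X; case: ifP.
Qed.

Definition quot_form_fun q (w : extform N q) (v : 'I_q -> quotmod) : B :=
  mkres (w (fun i => qrep (v i))).

Lemma quot_form_funE q (w : extform N q) (x : 'I_q -> N) :
  quot_form_fun w (fun i => mkquot (x i)) = mkres (w x).
Proof. by apply: form_res => i; rewrite qrepK. Qed.

Lemma quot_form_subst q (w : extform N q) v i x :
  quot_form_fun w (subst_at v i (mkquot x)) =
  mkres (w (subst_at (fun j => qrep (v j)) i x)).
Proof.
rewrite -quot_form_funE; congr quot_form_fun; apply: funext => j.
by rewrite /subst_at; case: eqP => // _; rewrite qrepK.
Qed.

Fact quot_form_lin q (w : extform N q) v i a x y :
  quot_form_fun w (subst_at v i (a *: x + y)) =
  a * quot_form_fun w (subst_at v i x) + quot_form_fun w (subst_at v i y).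
Proof.
elim/res_ind: a => a; elim/quot_ind: x => x; elim/quot_ind: y => y.
by rewrite -mkquotZ -mkquotD !quot_form_subst form_lin mkresD mkresM.
Qed.

Fact quot_form_alt q (w : extform N q) v i j :
  i != j -> v i = v j -> quot_form_fun w v = 0.
Proof.
move=> ij e; rewrite /quot_form_fun (@form_alt _ _ _ w _ i j) // ?e //.
by rewrite /mkres rmorph0.
Qed.

Definition quot_form q (w : extform N q) : extform quotmod q :=
  MkForm (quot_form_lin w) (@quot_form_alt q w).

End QuotientModule.

Arguments mkquot {A} I {N} x.
Arguments mkres {A} I a.
Arguments quot_lin {A} I {N} theta.
Arguments quot_form {A} I {N q} w.

Section Meromorphic.
Variable R : comNzRingType.
Local Notation M := (Der R).
Local Notation Rfr := (fracring R).
Local Notation Mfr := (localized (Der R)).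

(* eta / c; the inverse is a genuine one only when c is a non-zero-divisor.     *)
Definition form_div q (eta : extform M q) (c : R) : extform Mfr q :=
  (frac_embed c)^-1 *: loc_form eta.

Definition meromorphic_with_divisor q (w : extform Mfr q) (c : R) : Prop :=
  [/\ nzd c, exists eta, w = form_div eta c, ~ invertible c &
      ~ exists eta' c', invertible c' /\ w = form_div eta' c'].

Definition reduced_repr k (f : 'I_k -> R) q (w : extform Mfr q) (eta : extform M q) :
    Prop :=
  [/\ forall i, prime_elt (f i),
      forall i j, i != j -> ~ associated (f i) (f j),
      forall i, ~ exists eta', eta = f i *: eta',
      meromorphic_with_divisor w (\prod_i f i)
    & w = form_div eta (\prod_i f i)].

Definition cofactor_prod k (f : 'I_k -> R) (i : 'I_k) : R :=
  \prod_(j | j != i) f j.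

Definition log_condition k (f : 'I_k -> R) q (w : extform Mfr q) : Prop :=
  forall i, exists zeta : 'I_k -> extform M q.+1,
    wedge (loc_lin (differential (f i))) w =
    \sum_j form_div (zeta j) (cofactor_prod f j).

Definition dlog (f : R) : {linear Mfr -> Rfr^o} :=
  (frac_embed f)^-1 \*: loc_lin (differential f).

(* [LR hkp f b w gamma] is the representation of b w as                       *)
(* df_1/f_1 /\ ... /\ df_k/f_k /\ gamma + \sum_i xi_i / \hat f_i.             *)
Definition LR k p (hkp : (k <= p)%N) (f : 'I_k -> R) (b : R) (w : extform Mfr p)
    (gamma : extform M (p - k)) : Prop :=
  exists xi : 'I_k -> extform M p,
    frac_embed b *: w =
    cast_form (subnKC hkp) (wedges (fun i => dlog (f i)) (loc_form gamma)) +
    \sum_i form_div (xi i) (cofactor_prod f i).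

Definition dwedge k (f : 'I_k -> R) : extform M (k + 0) :=
  wedges (fun i => differential (f i)) (const_form M 1).

Section Residue.
Variable I : idealr R.
Local Notation Mbar := (quotmod I M).

Definition dwedge_bar k (f : 'I_k -> R) : extform Mbar (k + 0) :=
  wedges (fun i => quot_lin I (differential (f i))) (const_form Mbar 1).

Definition in_kernel k (f : 'I_k -> R) (x : localized Mbar) : Prop :=
  forall i, loc_lin (quot_lin I (differential (f i))) x = 0.

Definition residue_form q (b : R) (gamma : extform M q) : extform (localized Mbar) q :=
  (frac_embed (mkres I b))^-1 *: loc_form (quot_form I gamma).

End Residue.

End Meromorphic.

Arguments in_kernel {R} I {k} f x.
Arguments residue_form {R} I {q} b gamma.

(* Main.v *)
(* Multiplying by f_1 ... f_k, (LR) says that b eta = df_1 /\ ... /\ df_k /\      *)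
(* gamma modulo I, and the logarithmic condition says that df_i /\ eta = 0       *)
(* modulo I for all i. Write theta_i = df_i and Theta for their product.         *)
(* (i) For a k x k minor a of (theta_i) there are vectors Y_j with               *)
(* theta_i(Y_j) = a delta_ij, and contracting theta_i /\ eta = 0 with Y_i gives  *)
(* a eta = theta_i /\ (contraction of eta); after k steps, a^k eta is a multiple *)
(* of Theta. The b with this property form an ideal, so a power of every         *)
(* element of the ideal of minors has it.                                        *)
(* (ii) Start a regular sequence with a, put b = a^n, b eta = Theta /\ gamma.     *)
(* Modulo b, Theta /\ gamma = 0, hence gamma = sum theta_i /\ gamma_i + b gamma'  *)
(* by Saito's division lemma, so that b eta = b Theta /\ gamma' and b cancels.    *)
(* (iii) Two reduced divisors of omega have associated factors. Cross-multiplying *)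
(* two representations (LR) gives Theta /\ beta = 0 modulo I for a combination   *)
(* beta of gamma and gamma'; by Cramer's rule a^n beta lies in the ideal of the  *)
(* theta_i, so beta vanishes on the common kernel when a is a non-zero-divisor.  *)
From HB Require Import structures.
Require Import Defs.
From mathcomp Require Import all_boot all_fingroup all_algebra.
From mathcomp Require Import ring boolp.
Set Implicit Arguments.
Unset Strict Implicit.
Unset Printing Implicit Defensive.
Import GRing.Theory.
Local Open Scope ring_scope.

(** * Graded forms, contractions and truncations *)

(** Clearing denominators ([LRP]) turns everything into congruences modulo the ideal generated by
    the [f i]: the logarithmic condition says that each [df_i] kills the numerator [eta], and (LR)
    says that [b *: eta] is divisible by the product theta of the [df_i]. Division by theta rests on
    one identity, [gcontract_gwedge]: contraction with a vector is an antiderivation of the wedge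
    product.

    Contracting with vectors dual to the [df_i] up to a minor yields [cramer_division] and
    [cramer_kernel]; [coef_ideal_exponent] extends both from minors to the whole ideal they
    generate, with a uniform exponent, and this gives (i). For (ii) the power of [a] must be
    cancelled: [saito_division] shows that a form killed by theta lies in the ideal of the [df_i]
    when its degree is small against the length of a regular sequence, and [wedge_division]
    concludes. Working modulo an arbitrary ideal predicate lets the induction adjoin elements
    without forming new quotient rings.

    For (iii), [reduced_factor] compares the prime factors of two reduced divisors, and
    [residue_unique] compares two residues through [cramer_kernel] and a coefficient that is a
    non-zero-divisor modulo the ideal. *)

Section GradedForms.
Variables (A : comNzRingType) (N : lmodType A).
Local Notation form := (extform N).

(* Forms of all degrees at once: wedge products and contractions then compose  *)
(* without casts between extform N (k + q) and extform N p.                    *)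
Definition gform : Type := forall q, form q.
HB.instance Definition _ := gen_eqMixin gform.
HB.instance Definition _ := gen_choiceMixin gform.

Lemma gformP (w1 w2 : gform) : (forall q, w1 q = w2 q) -> w1 = w2.
Proof. exact: functional_extensionality_dep. Qed.

Fact gform_addA : associative (fun w1 w2 : gform => (fun q => w1 q + w2 q) : gform).
Proof. by move=> u v w; apply: gformP => q; apply: addrA. Qed.
Fact gform_addC : commutative (fun w1 w2 : gform => (fun q => w1 q + w2 q) : gform).
Proof. by move=> u v; apply: gformP => q; apply: addrC. Qed.
Fact gform_add0 : left_id ((fun q => 0) : gform)
  (fun w1 w2 : gform => (fun q => w1 q + w2 q) : gform).
Proof. by move=> u; apply: gformP => q; apply: add0r. Qed.
Fact gform_addN : left_inverse ((fun q => 0) : gform)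
  (fun w : gform => (fun q => - w q) : gform)
  (fun w1 w2 : gform => (fun q => w1 q + w2 q) : gform).
Proof. by move=> u; apply: gformP => q; apply: addNr. Qed.
HB.instance Definition _ :=
  GRing.isZmodule.Build gform gform_addA gform_addC gform_add0 gform_addN.

Definition gform_scale (a : A) (w : gform) : gform := fun q => a *: w q.
Fact gform_scaleA a b w : gform_scale a (gform_scale b w) = gform_scale (a * b) w.
Proof. by apply: gformP => q; apply: scalerA. Qed.
Fact gform_scale1 : left_id 1 gform_scale.
Proof. by move=> w; apply: gformP => q; apply: scale1r. Qed.
Fact gform_scaleDr : right_distributive gform_scale +%R.
Proof. by move=> a u v; apply: gformP => q; apply: scalerDr. Qed.
Fact gform_scaleDl w : {morph gform_scale^~ w : a b / a + b}.
Proof. by move=> a b; apply: gformP => q; apply: scalerDl. Qed.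
HB.instance Definition _ := GRing.Zmodule_isLmodule.Build A gform
  gform_scaleA gform_scale1 gform_scaleDr gform_scaleDl.

Lemma formDE q (w1 w2 : form q) v : (w1 + w2) v = w1 v + w2 v. Proof. by []. Qed.
Lemma formNE q (w : form q) v : (- w) v = - w v. Proof. by []. Qed.
Lemma formZE q a (w : form q) v : (a *: w) v = a * w v. Proof. by []. Qed.
Lemma form0E q v : (0 : form q) v = 0. Proof. by []. Qed.
Lemma form_sumE q I (r : seq I) (P : pred I) (F : I -> form q) v :
  (\sum_(i <- r | P i) F i) v = \sum_(i <- r | P i) F i v.
Proof. exact: (big_morph (fun w : form q => w v)). Qed.

Lemma gformDE (w1 w2 : gform) q : (w1 + w2) q = w1 q + w2 q. Proof. by []. Qed.
Lemma gformNE (w : gform) q : (- w) q = - w q. Proof. by []. Qed.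
Lemma gformZE a (w : gform) q : (a *: w) q = a *: w q. Proof. by []. Qed.
Lemma gform_sumE I (r : seq I) (P : pred I) (F : I -> gform) q :
  (\sum_(i <- r | P i) F i) q = \sum_(i <- r | P i) F i q.
Proof. exact: (big_morph (fun w : gform => w q)). Qed.

Definition vcons q (x : N) (v : 'I_q -> N) : 'I_q.+1 -> N :=
  fun i => if unlift ord0 i is Some j then v j else x.

Lemma vcons0 q x (v : 'I_q -> N) : vcons x v ord0 = x.
Proof. by rewrite /vcons unlift_none. Qed.
Lemma vconsS q x (v : 'I_q -> N) i : vcons x v (lift ord0 i) = v i.
Proof. by rewrite /vcons liftK. Qed.
Lemma vcons_eta q (v : 'I_q.+1 -> N) : v = vcons (v ord0) (v \o lift ord0).
Proof.
apply: funext => i; case: (unliftP ord0 i) => [j ->|->]; last by rewrite vcons0.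
by rewrite vconsS.
Qed.
Lemma vcons_lift0 q x (v : 'I_q -> N) : vcons x v \o lift ord0 = v.
Proof. by apply: funext => i /=; rewrite vconsS. Qed.
Lemma vcons_lift q x (v : 'I_q.+1 -> N) i :
  vcons x v \o lift (lift ord0 i) = vcons x (v \o lift i).
Proof.
apply: funext => j /=; case: (unliftP ord0 j) => [l ->|->].
  rewrite vconsS /= -[v _](vconsS x); congr (vcons x v _).
  by apply: val_inj; rewrite /= /bump !leq0n !add1n ltnS addnS.
by rewrite vcons0 (_ : lift _ _ = ord0) ?vcons0 //; apply: val_inj.
Qed.
Lemma subst_vcons q x (v : 'I_q -> N) i y :
  subst_at (vcons x v) (lift ord0 i) y = vcons x (subst_at v i y).
Proof.
apply: funext => j; rewrite /subst_at; case: (unliftP ord0 j) => [l ->|->].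
  by rewrite !vconsS (inj_eq (@lift_inj _ ord0)).
by rewrite !vcons0 (negPf (neq_lift _ _)).
Qed.
Lemma subst_vcons0 q x (v : 'I_q -> N) y :
  subst_at (vcons x v) ord0 y = vcons y v.
Proof.
apply: funext => j; rewrite /subst_at; case: (unliftP ord0 j) => [l ->|->].
  by rewrite !vconsS eq_sym (negPf (neq_lift _ _)).
by rewrite !vcons0 eqxx.
Qed.

(** * Interior product, exterior product and their sign rules *)

Section Contract.
Variables (q : nat) (x : N) (w : form q.+1).
Definition contract_fun (v : 'I_q -> N) : A := w (vcons x v).
Fact contract_lin v i a y z : contract_fun (subst_at v i (a *: y + z)) =
  a * contract_fun (subst_at v i y) + contract_fun (subst_at v i z).
Proof. by rewrite /contract_fun -!subst_vcons form_lin. Qed.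
Fact contract_alt v i j : i != j -> v i = v j -> contract_fun v = 0.
Proof.
move=> ij e; apply: (@form_alt _ _ _ w _ (lift ord0 i) (lift ord0 j)).
  by rewrite (inj_eq (@lift_inj _ ord0)).
by rewrite !vconsS.
Qed.
Definition contract : form q := MkForm contract_lin contract_alt.
End Contract.

Definition gcontract (x : N) (w : gform) : gform := fun q => contract x (w q.+1).
Fact gcontract_linear x : linear (gcontract x).
Proof. by move=> a u v; apply: gformP => q; apply: form_ext. Qed.
HB.instance Definition _ x :=
  GRing.isLinear.Build A gform gform *:%R (gcontract x) (gcontract_linear x).

Definition gwedge (t : {linear N -> A^o}) (w : gform) : gform :=
  fun q => if q is q'.+1 then wedge t (w q') else 0.
Fact gwedge_linear t : linear (gwedge t).
Proof.
move=> a u v; apply: gformP => -[|q].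
  by rewrite (gformDE (a *: gwedge t u)) gformZE scaler0 addr0.
rewrite (gformDE (a *: gwedge t u)) gformZE.
apply: form_ext => x; rewrite formDE formZE /= /wedge_fun.
rewrite mulr_sumr -big_split /=; apply: eq_bigr => i _.
by rewrite mulrDr mulrCA.
Qed.
HB.instance Definition _ t :=
  GRing.isLinear.Build A gform gform *:%R (gwedge t) (gwedge_linear t).

(** The index 0 term of the alternating sum evaluates [t] at [x]; in all others [x] stays an
    argument of [w] and the sign shifts by one. *)
Lemma gcontract_gwedge x t w :
  gcontract x (gwedge t w) = (t x : A) *: w - gwedge t (gcontract x w).
Proof.
apply: gformP => q; apply: form_ext => v.
rewrite !(gformDE, gformNE, gformZE, formDE, formNE, formZE) /=.
rewrite /contract_fun /= /wedge_fun big_ord_recl vcons0 vcons_lift0 expr0 mul1r.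
congr (_ + _); case: q v => [|q] v; first by rewrite big_ord0 form0E oppr0.
rewrite /= /wedge_fun -sumrN; apply: eq_bigr => i _.
by rewrite vconsS vcons_lift /bump leq0n exprS mulN1r !mulNr.
Qed.

(** Induction on the degree: a form of positive degree is determined by its contractions, and
    contracting lowers the degree. *)
Lemma gwedge_anticomm s t w : gwedge s (gwedge t w) = - gwedge t (gwedge s w).
Proof.
apply/eqP; rewrite -subr_eq0 opprK; apply/eqP; apply: gformP => q.
elim: q w => [|q IH] w; first by rewrite gformDE /= addr0.
apply: form_ext => v; rewrite (vcons_eta v); set x := v ord0; set v' := v \o _.
rewrite -[LHS]/(gcontract x (gwedge s (gwedge t w) + gwedge t (gwedge s w)) q v').
have -> : gcontract x (gwedge s (gwedge t w) + gwedge t (gwedge s w)) =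
    gwedge s (gwedge t (gcontract x w)) + gwedge t (gwedge s (gcontract x w)).
  rewrite linearD /= !gcontract_gwedge.
  rewrite [gwedge s (_ - _)]linearB [gwedge t (_ - _)]linearB !linearZ !opprB.
  by rewrite addrACA [X in _ + X]addrACA -opprD [t x *: _ + _]addrC addrC subrK.
by rewrite IH.
Qed.

Lemma gwedge_sqr0 t w : gwedge t (gwedge t w) = 0.
Proof.
apply: gformP => q; elim: q w => [//|q IH] w.
apply: form_ext => v; rewrite (vcons_eta v); set x := v ord0; set v' := v \o _.
rewrite -[LHS]/(gcontract x (gwedge t (gwedge t w)) q v').
by rewrite !gcontract_gwedge linearB linearZ /= opprB addrC subrK IH.
Qed.

Lemma gcontract_anticomm x y w :
  gcontract x (gcontract y w) = - gcontract y (gcontract x w).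
Proof.
apply: gformP => q; apply: form_ext => v.
rewrite gformNE formNE /= /contract_fun /= /contract_fun.
have i01 : ord0 != lift ord0 ord0 :> 'I_q.+2 by [].
rewrite -(form_tperm _ _ i01); congr (w _ _); apply: funext => i /=.
case: tpermP => [->|->|/eqP i0 /eqP i1].
- by rewrite vconsS !vcons0.
- by rewrite vconsS !vcons0.
case: (unliftP ord0 i) i0 i1 => [j -> _|->]; last by rewrite eqxx.
rewrite (inj_eq (@lift_inj _ ord0)) => j0; rewrite !vconsS.
by case: (unliftP ord0 j) j0 => [l ->|->]; rewrite ?eqxx // !vconsS.
Qed.

Lemma gcontract_sqr0 x w : gcontract x (gcontract x w) = 0.
Proof.
apply: gformP => q; apply: form_ext => v.
rewrite /= /contract_fun /= /contract_fun.
by rewrite (@form_alt _ _ _ _ _ ord0 (lift ord0 ord0)) // vconsS !vcons0.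
Qed.

(** A degree bound: in degrees below [d], a product with [d] or more linear forms is zero. *)
Definition trunc (d : nat) (w : gform) : gform := fun q => if (q < d)%N then w q else 0.
Fact trunc_linear d : linear (trunc d).
Proof.
move=> a u v; apply: gformP => q; rewrite (gformDE (a *: trunc d u)) gformZE /trunc.
by case: ltnP => // _; rewrite scaler0 addr0.
Qed.
HB.instance Definition _ d :=
  GRing.isLinear.Build A gform gform *:%R (trunc d) (trunc_linear d).

Lemma trunc0 w : trunc 0 w = 0. Proof. by []. Qed.

Lemma trunc_trunc c d w : (c <= d)%N -> trunc d (trunc c w) = trunc c w.
Proof.
move=> cd; apply: gformP => q; rewrite /trunc; case: (ltnP q c) => [qc|]; last by rewrite if_same.
by rewrite (leq_trans qc cd).
Qed.

Lemma wedge0r q (t : {linear N -> A^o}) : wedge t (0 : form q) = 0.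
Proof. by apply: form_ext => v; rewrite /= /wedge_fun big1 // => i _; rewrite mulr0. Qed.

Lemma trunc_gwedge d t w : trunc d (gwedge t w) = gwedge t (trunc d.-1 w).
Proof.
apply: gformP => -[|q]; rewrite /trunc /=; first by rewrite if_same.
case: d => [|d] /=; first by rewrite wedge0r.
by rewrite ltnS; case: ltnP => // _; rewrite wedge0r.
Qed.

End GradedForms.

(** * Regular sequences modulo an ideal *)

Section Ideals.
Variable A : comNzRingType.
Implicit Types (K : A -> Prop) (a b x y : A).

Definition ideal_pred K : Prop :=
  [/\ K 0, forall x y, K x -> K y -> K (x + y) & forall a x, K x -> K (a * x)].

Section Closure.
Variables (K : A -> Prop) (hK : ideal_pred K).

Lemma ideal0 : K 0. Proof. by case: hK. Qed.
Lemma idealD x y : K x -> K y -> K (x + y). Proof. by case: hK => _ h _; apply: h. Qed.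
Lemma idealM a x : K x -> K (a * x). Proof. by case: hK => _ _; apply. Qed.
Lemma idealMl a x : K x -> K (x * a). Proof. by rewrite mulrC; apply: idealM. Qed.
Lemma idealN x : K x -> K (- x). Proof. by rewrite -mulN1r; apply: idealM. Qed.
Lemma idealB x y : K x -> K y -> K (x - y).
Proof. by move=> hx hy; apply/idealD/idealN. Qed.
Lemma ideal_sum I (r : seq I) (P : pred I) (F : I -> A) :
  (forall i, P i -> K (F i)) -> K (\sum_(i <- r | P i) F i).
Proof. exact: (big_ind _ ideal0 idealD). Qed.

End Closure.

Definition adjoin K (T : finType) (g : T -> A) x : Prop :=
  exists c : T -> A, K (x - \sum_t c t * g t).

Lemma adjoin_ideal K (T : finType) (g : T -> A) :
  ideal_pred K -> ideal_pred (adjoin K g).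
Proof.
move=> hK; split=> [|x y [c hc] [d hd]|a x [c hc]].
- exists (fun=> 0); rewrite big1 ?subr0 => [|t _]; [exact: ideal0 | exact: mul0r].
- exists (fun t => c t + d t); rewrite (_ : _ - _ =
    (x - \sum_t c t * g t) + (y - \sum_t d t * g t)); first exact: idealD.
  by under eq_bigr do rewrite mulrDl; rewrite big_split opprD addrACA.
- exists (fun t => a * c t); under eq_bigr do rewrite -mulrA.
  by rewrite -mulr_sumr -mulrBr; apply: idealM.
Qed.

Definition adjoin1 K b : A -> Prop := adjoin K (fun _ : 'I_1 => b).

Lemma adjoin1P K b x : adjoin1 K b x <-> exists c, K (x - c * b).
Proof.
split=> [[c]|[c h]]; first by rewrite big_ord1; exists (c ord0).
by exists (fun=> c); rewrite big_ord1.
Qed.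

Lemma adjoin1_ideal K b : ideal_pred K -> ideal_pred (adjoin1 K b).
Proof. exact: adjoin_ideal. Qed.

(** Cancellation along the sequence, with [K] enlarged at each step in place of a passage to the
    quotient ring. *)
Fixpoint regular_mod K (s : seq A) : Prop :=
  if s is a :: s' then nzd_mod K a /\ regular_mod (adjoin1 K a) s' else True.

Lemma nzd_modX K a n : nzd_mod K a -> nzd_mod K (a ^+ n).
Proof.
move=> ha; elim: n => [|n IH] x; first by rewrite mul1r.
by rewrite exprS -mulrA => /ha/IH.
Qed.

(** If [a * x] is [y * b] modulo [K], then [b * y] lies in [K + (a)], so [y] is a multiple [z * a]
    modulo [K], and cancelling [a] leaves [x = z * b]. *)
Lemma nzd_mod_swap K a b : ideal_pred K ->
  nzd_mod K a -> nzd_mod (adjoin1 K a) b -> nzd_mod (adjoin1 K b) a.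
Proof.
move=> hK ha hb x /adjoin1P[y hy].
have /hb/adjoin1P[z hz] : adjoin1 K a (b * y).
  apply/adjoin1P; exists x; rewrite (_ : _ - _ = - (a * x - y * b)); last by ring.
  exact: idealN.
apply/adjoin1P; exists z; apply: ha.
rewrite (_ : _ * _ = (a * x - y * b) + b * (y - z * a)); last by ring.
by apply: idealD => //; apply: idealM.
Qed.

(** One factor [a] is peeled off at a time: [x = z * a] modulo [K], and after cancelling [a] the
    induction hypothesis applies to [z]. *)
Lemma nzd_mod_adjoinX K a b n : ideal_pred K ->
  nzd_mod K a -> nzd_mod (adjoin1 K a) b -> nzd_mod (adjoin1 K (a ^+ n)) b.
Proof.
move=> hK ha hb; elim: n => [|n IH] x /adjoin1P[y hy].
  by apply/adjoin1P; exists x; rewrite expr0 mulr1 subrr; apply: ideal0.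
have /hb/adjoin1P[z hz] : adjoin1 K a (b * x).
  by apply/adjoin1P; exists (y * a ^+ n); rewrite -mulrA -exprSr.
have /IH/adjoin1P[c hc] : adjoin1 K (a ^+ n) (b * z).
  apply/adjoin1P; exists y; apply: ha.
  rewrite (_ : _ * _ = (b * x - y * a ^+ n.+1) - b * (x - z * a)).
    by apply: idealB => //; apply: idealM.
  by rewrite exprS; ring.
apply/adjoin1P; exists c.
rewrite (_ : _ - _ = (x - z * a) + a * (z - c * a ^+ n)); last by rewrite exprS; ring.
by apply: idealD => //; apply: idealM.
Qed.

Lemma adjoin1C K a b x : adjoin1 (adjoin1 K a) b x <-> adjoin1 (adjoin1 K b) a x.
Proof.
have H c d : adjoin1 (adjoin1 K c) d x -> adjoin1 (adjoin1 K d) c x.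
  move=> /adjoin1P[y /adjoin1P[z h]]; apply/adjoin1P; exists z; apply/adjoin1P.
  by exists y; rewrite addrAC.
by split; apply: H.
Qed.

Lemma adjoin1_swap K a b : adjoin1 (adjoin1 K a) b = adjoin1 (adjoin1 K b) a.
Proof. by apply: funext => x; apply/propext/adjoin1C. Qed.

(** Allows the Cramer multiplier [a ^+ n] to take the place of [a] at the head of a regular
    sequence. The induction exchanges [a] with the next element. *)
Lemma regular_mod_adjoinX K a n s : ideal_pred K ->
  nzd_mod K a -> regular_mod (adjoin1 K a) s -> regular_mod (adjoin1 K (a ^+ n)) s.
Proof.
elim: s K => [//|b s IH] K hK ha [hb hs]; split; first exact: nzd_mod_adjoinX.
rewrite adjoin1_swap; apply: IH; [exact: adjoin1_ideal | exact: nzd_mod_swap |].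
by rewrite adjoin1_swap.
Qed.

Lemma ideal_exprD K x y n l : ideal_pred K -> K (x ^+ n) -> K (y ^+ l) -> K ((x + y) ^+ (n + l)).
Proof.
move=> hK hx hy; rewrite exprDn; apply: (ideal_sum hK) => i _.
rewrite -mulr_natl; apply: (idealM hK); have [li|il] := leqP l i.
  by rewrite -(subnK li) (exprD y); do 2 apply: (idealM hK).
have ni : (n <= n + l - i)%N by rewrite -addnBA ?leq_addr // ltnW.
by rewrite -(subnK ni) (exprD x) -mulrA mulrCA; apply: (idealMl hK).
Qed.

Lemma ideal_radical_gen K (T : finType) (g : T -> A) n : ideal_pred K ->
  (forall t, K (g t ^+ n)) -> exists l, forall a, in_gen g a -> K (a ^+ l).
Proof.
(* Each generator contributes [n] to the exponent; the extra 1 makes the power of the empty sum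
   zero. *)
move=> hK hg; exists (n * #|T|).+1 => _ [c ->].
rewrite cardT enumT -[index_enum T]/(Finite.enum T).
elim: (Finite.enum T) => [|t r IH]; first by rewrite big_nil muln0 expr1; apply: ideal0.
rewrite big_cons mulnS -addnS; apply: ideal_exprD => //.
by rewrite exprMn; apply: (idealM hK).
Qed.

End Ideals.

(** * Forms modulo an ideal *)

Section Congruence.
Variables (A : comNzRingType) (N : lmodType A).
Local Notation gform := (gform N).

Lemma linform_vcons q (w : extform N q.+1) x y a v :
  w (vcons (a *: x + y) v) = a * w (vcons x v) + w (vcons y v).
Proof. by have := form_lin w (vcons x v) ord0 a x y; rewrite !subst_vcons0. Qed.

Lemma gcontract_sum I (r : seq I) (c : I -> A) (x : I -> N) (w : gform) :
  gcontract (\sum_(i <- r) c i *: x i) w = \sum_(i <- r) c i *: gcontract (x i) w.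
Proof.
apply: gformP => q; rewrite gform_sumE; apply: form_ext => v; rewrite form_sumE.
rewrite [LHS]/=/contract_fun; elim: r => [|i r IH].
  by rewrite !big_nil -(subst_vcons0 0 v) form_subst0.
by rewrite !big_cons linform_vcons IH.
Qed.

Definition gform_in (K : A -> Prop) (w : gform) : Prop := forall q v, K (w q v).

Section Ideal.
Variables (K : A -> Prop) (hK : ideal_pred K).

Lemma gform_in0 : gform_in K 0. Proof. by move=> q v; apply: ideal0. Qed.
Lemma gform_inD u w : gform_in K u -> gform_in K w -> gform_in K (u + w).
Proof. by move=> hu hw q v; apply: idealD. Qed.
Lemma gform_inN w : gform_in K w -> gform_in K (- w).
Proof. by move=> hw q v; apply: idealN. Qed.
Lemma gform_inZ a w : gform_in K w -> gform_in K (a *: w).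
Proof. by move=> hw q v; apply: idealM. Qed.
Lemma gform_inZl a w : K a -> gform_in K (a *: w).
Proof. by move=> ha q v; apply: idealMl. Qed.
Lemma gform_in_sum I (r : seq I) (P : pred I) (F : I -> gform) :
  (forall i, P i -> gform_in K (F i)) -> gform_in K (\sum_(i <- r | P i) F i).
Proof. exact: (big_ind _ gform_in0 gform_inD). Qed.
Lemma gform_in_wedge t w : gform_in K w -> gform_in K (gwedge t w).
Proof.
move=> hw [|q] v; first exact: ideal0.
by apply: (ideal_sum hK) => i _; apply: (idealM hK); apply: hw.
Qed.
Lemma gform_in_contract x w : gform_in K w -> gform_in K (gcontract x w).
Proof. by move=> hw q v; apply: hw. Qed.
Lemma gform_in_trunc d w : gform_in K w -> gform_in K (trunc d w).
Proof. by move=> hw q v; rewrite /trunc; case: ifP => _; [apply: hw | apply: ideal0]. Qed.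

End Ideal.

Lemma gform_in_nzd K a w : nzd_mod K a -> gform_in K (a *: w) -> gform_in K w.
Proof. by move=> ha hw q v; apply: ha; apply: hw. Qed.

End Congruence.

(** * Coordinates and lifting of congruences between forms *)

Section Basis.
Variables (A : comNzRingType) (N : lmodType A) (m : nat) (e : 'I_m -> N) (he : is_basis e).
Local Notation gform := (gform N).

Definition basis_coord (i : 'I_m) (x : N) : A^o := sval (cid (he x)) 0 i.

Lemma basis_coordE x : x = \sum_i (basis_coord i x : A) *: e i.
Proof. by have [] := svalP (cid (he x)). Qed.

Lemma basis_coord_eq x (c : 'I_m -> A) i : x = \sum_i c i *: e i -> basis_coord i x = c i.
Proof.
move=> ex; have [_ /(_ (\row_i c i))] := svalP (cid (he x)).
rewrite /basis_coord => ->; first by rewrite mxE.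
by rewrite {1}ex; apply: eq_bigr => j _; rewrite mxE.
Qed.

Fact basis_coord_linear i : linear (basis_coord i).
Proof.
move=> a x y.
rewrite (@basis_coord_eq _ (fun i => a * basis_coord i x + basis_coord i y)) //.
under eq_bigr do rewrite scalerDl -scalerA.
by rewrite big_split -scaler_sumr -!basis_coordE.
Qed.
HB.instance Definition _ i :=
  GRing.isLinear.Build A N A^o *:%R (basis_coord i) (basis_coord_linear i).

Lemma basis_coord_basis i j : basis_coord i (e j) = (i == j)%:R.
Proof.
apply: (@basis_coord_eq _ (fun i => (i == j)%:R)).
by rewrite (bigD1 j) //= eqxx scale1r big1 ?addr0 // => l /negPf ->; rewrite scale0r.
Qed.

(* With L and P the wedge product by a coordinate and the contraction with the *)
(* basis vector, w = P L w + L P w, and P L w, P w no longer involve that      *)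
(* coordinate; this reduces the lifting of w to that of a constant.            *)
Lemma gform_adjoin K (T : finType) (g : T -> A) (w : gform) : ideal_pred K ->
  gform_in (adjoin K g) w -> exists u : T -> gform, gform_in K (w - \sum_t g t *: u t).
Proof.
move=> hK; have hJ := adjoin_ideal g hK.
have : forall i, i \notin enum 'I_m -> gcontract (e i) w = 0.
  by move=> i; rewrite mem_enum.
elim: (enum 'I_m) w => [|i l IH] w hw Jw.
  (* All contractions with basis vectors vanish, so only the constant term survives and the
     hypothesis on its single value suffices. *)
  have w0 q : w q.+1 = 0.
    apply: form_ext => v; rewrite (vcons_eta v); set x := v ord0; set v' := v \o _.
    rewrite -[LHS]/(gcontract x w q v') (basis_coordE x) gcontract_sum big1 // => i _.
    by rewrite hw // scaler0.
  have [c hc] := Jw 0 (fun=> 0).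
  exists (fun t q => if q is 0 then const_form N (c t) else 0) => -[|q] v.
    rewrite gformDE gformNE gform_sumE formDE formNE form_sumE.
    rewrite (_ : v = fun=> 0); last by apply: funext => -[].
    rewrite (_ : \sum_t _ = \sum_t c t * g t) //.
    by apply: eq_bigr => t _; rewrite mulrC.
  rewrite gformDE gformNE gform_sumE formDE formNE form_sumE w0 form0E sub0r.
  by rewrite big1 ?oppr0 => [|t _]; [exact: ideal0 | rewrite gformZE formZE mulr0].
pose L : {linear gform -> gform} := gwedge (basis_coord i).
pose P : {linear gform -> gform} := gcontract (e i).
have dec u : u = P (L u) + L (P u).
  by rewrite /L /P /= gcontract_gwedge /= basis_coord_basis eqxx scale1r subrK.
have Pi u : P (P u) = 0 by apply: gcontract_sqr0.
have Lj u j : j != i -> gcontract (e j) u = 0 -> gcontract (e j) (L u) = 0.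
  move=> ji hu; rewrite gcontract_gwedge /= basis_coord_basis eq_sym (negPf ji).
  by rewrite scale0r sub0r hu linear0 oppr0.
have Pj u j : gcontract (e j) u = 0 -> gcontract (e j) (P u) = 0.
  by move=> hu; rewrite gcontract_anticomm hu linear0 oppr0.
have [|u hu] := IH (P (L w)) _ (gform_in_contract _ (gform_in_wedge hJ _ Jw)).
  move=> j jl; have [->|ji] := eqVneq j i; first exact: Pi.
  by apply: Pj; apply: Lj => //; apply: hw; rewrite inE negb_or ji.
have [|u' hu'] := IH (P w) _ (gform_in_contract _ Jw).
  move=> j jl; have [->|ji] := eqVneq j i; first exact: Pi.
  by apply: Pj; apply: hw; rewrite inE negb_or ji.
exists (fun t => u t + L (u' t)).
rewrite (_ : _ - _ = (P (L w) - \sum_t g t *: u t) + L (P w - \sum_t g t *: u' t)).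
  by apply: gform_inD => //; apply: gform_in_wedge.
rewrite [L (_ - _)]linearB [L (\sum_t _)]linear_sum addrACA -dec -opprD -big_split.
by congr (_ - _); apply: eq_bigr => t _; rewrite scalerDr linearZ.
Qed.

Lemma gform_adjoin1 K b (w : gform) : ideal_pred K ->
  gform_in (adjoin1 K b) w -> exists u : gform, gform_in K (w - b *: u).
Proof.
by move=> hK /(gform_adjoin hK)[u]; rewrite big_ord1; exists (u ord0).
Qed.

End Basis.

(** * Products of linear forms and Cramer's rule *)

Section Products.
Variables (A : comNzRingType) (N : lmodType A) (k : nat) (t : 'I_k -> {linear N -> A^o}).
Local Notation gform := (gform N).
Implicit Types (l : seq 'I_k) (w : gform).

Definition gwedges l w : gform := foldr (fun i => gwedge (t i)) w l.

Fact gwedges_linear l : linear (gwedges l).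
Proof. by move=> a u w; elim: l => [//|i l IH]; rewrite /= IH linearP. Qed.
HB.instance Definition _ l :=
  GRing.isLinear.Build A gform gform *:%R (gwedges l) (gwedges_linear l).

Lemma gwedges_cat l1 l2 w : gwedges (l1 ++ l2) w = gwedges l1 (gwedges l2 w).
Proof. exact: foldr_cat. Qed.

Lemma gwedge_gwedges i l w :
  gwedge (t i) (gwedges l w) = (-1) ^+ size l *: gwedges l (gwedge (t i) w).
Proof.
elim: l => [|j l IH]; first by rewrite scale1r.
by rewrite /= gwedge_anticomm IH linearZ exprS mulN1r scaleNr.
Qed.

Lemma gwedges_comm l1 l2 w :
  gwedges l1 (gwedges l2 w) = (-1) ^+ (size l1 * size l2) *: gwedges l2 (gwedges l1 w).
Proof.
elim: l1 => [|i l1 IH]; first by rewrite scale1r.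
by rewrite /= IH linearZ /= gwedge_gwedges scalerA -exprD mulSn addnC.
Qed.

Lemma gwedges_dup i l w : i \in l -> gwedge (t i) (gwedges l w) = 0.
Proof.
elim: l => [//|j l IH]; rewrite inE; case: eqP => [<- _|_ /= il].
  by rewrite /= gwedge_sqr0.
by rewrite /= gwedge_anticomm IH // linear0 oppr0.
Qed.

Lemma gwedges_not_uniq l w : ~~ uniq l -> gwedges l w = 0.
Proof.
elim: l => [//|i l IH] /=; rewrite negb_and negbK => /orP[|/IH ->].
  exact: gwedges_dup.
exact: linear0.
Qed.

(** The sign is left existential: later uses only need that it is independent of [w] and squares to
    1. *)
Lemma gwedges_perm l1 l2 : perm_eq l1 l2 ->
  exists b : bool, forall w, gwedges l1 w = (-1) ^+ b *: gwedges l2 w.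
Proof.
move=> p12; pose P l := exists b : bool, forall w, gwedges l1 w = (-1) ^+ b *: gwedges l w.
apply: (@catCA_perm_ind _ P _ l1 l2 p12); last by exists false => w; rewrite scale1r.
move=> s1 s2 s3 [b hb]; exists (b (+) odd (size s1 * size s2)) => w.
by rewrite hb !gwedges_cat gwedges_comm signr_addb signr_odd scalerA.
Qed.

Lemma trunc_gwedges d l w : trunc d (gwedges l w) = gwedges l (trunc (d - size l) w).
Proof.
elim: l d => [|i l IH] d; first by rewrite subn0.
by rewrite /= trunc_gwedge IH -subn1 -subnDA add1n.
Qed.

Lemma gform_in_gwedges K l w : ideal_pred K -> gform_in K w -> gform_in K (gwedges l w).
Proof. by move=> hK hw; elim: l => [//|i l IH]; apply: gform_in_wedge. Qed.

Definition set_wedge (S : {set 'I_k}) w : gform := gwedges (enum S) w.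
HB.instance Definition _ S := GRing.Linear.copy (set_wedge S) (gwedges (enum S)).

(** Having the size of [S] without being [S], the set [S'] meets the complement, so a linear form is
    repeated. Multiplying by the complementary product thus isolates the coefficient of [S]. *)
Lemma set_wedge_complement (S S' : {set 'I_k}) w : #|S'| = #|S| -> S' != S ->
  set_wedge (~: S) (set_wedge S' w) = 0.
Proof.
move=> cS neS; rewrite /set_wedge -gwedges_cat gwedges_not_uniq //.
rewrite cat_uniq !enum_uniq andbT /= negbK; apply/hasP.
have /subsetPn[i iS' iS] : ~~ (S' \subset S).
  by apply: contra neS => sS; rewrite eqEcard sS cS /=.
by exists i; rewrite /= mem_enum // inE.
Qed.

Lemma set_wedge_complement_id (S : {set 'I_k}) :
  exists b : bool, forall w, set_wedge (~: S) (set_wedge S w) =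
    (-1) ^+ b *: gwedges (enum 'I_k) w.
Proof.
have /gwedges_perm[b hb] : perm_eq (enum (~: S) ++ enum S) (enum 'I_k).
  apply: uniq_perm; rewrite ?enum_uniq //.
    rewrite cat_uniq !enum_uniq andbT; apply/hasPn => i /=.
    by rewrite !mem_enum inE negbK.
  by move=> i; rewrite mem_cat !mem_enum inE orNb.
by exists b => w; rewrite -hb gwedges_cat.
Qed.

(* The image of the r-th power of the ideal (t_1, ..., t_k) of the exterior     *)
(* algebra.                                                                   *)
Definition wedge_filtration r w : Prop :=
  exists d : {set 'I_k} -> gform, w = \sum_(S : {set 'I_k} | #|S| == r) set_wedge S (d S).

Lemma wedge_filtrationD r u w :
  wedge_filtration r u -> wedge_filtration r w -> wedge_filtration r (u + w).
Proof.
move=> [c ->] [d ->]; exists (fun S => c S + d S).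
by rewrite -big_split; apply: eq_bigr => S _; rewrite linearD.
Qed.

Lemma wedge_filtration0 r : wedge_filtration r 0.
Proof. by exists (fun=> 0); rewrite big1 // => S _; apply: linear0. Qed.

Lemma wedge_filtrationZ r a w : wedge_filtration r w -> wedge_filtration r (a *: w).
Proof.
move=> [d ->]; exists (fun S => a *: d S).
by rewrite scaler_sumr; apply: eq_bigr => S _; rewrite linearZ.
Qed.

Lemma wedge_filtration_sum r I (s : seq I) (P : pred I) (F : I -> gform) :
  (forall i, P i -> wedge_filtration r (F i)) ->
  wedge_filtration r (\sum_(i <- s | P i) F i).
Proof. exact: (big_ind _ (wedge_filtration0 r) (@wedge_filtrationD r)). Qed.

Lemma wedge_filtration_gwedges l w : wedge_filtration (size l) (gwedges l w).
Proof.
have [ul|/gwedges_not_uniq ->] := boolP (uniq l); last exact: wedge_filtration0.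
pose S := [set i in l].
have /gwedges_perm[b hb] : perm_eq l (enum S).
  by apply: uniq_perm; rewrite ?enum_uniq // => i; rewrite mem_enum inE.
exists (fun S' => if S' == S then (-1) ^+ b *: w else 0).
rewrite (bigD1 S) /= ?eqxx ?big1 ?addr0 => [|S' /andP[_ /negPf ->]|].
- by rewrite hb linearZ.
- exact: linear0.
- by rewrite /S cardsE; apply/eqP/card_uniqP.
Qed.

Lemma wedge_filtration1_wedge i w : wedge_filtration 1 (gwedge (t i) w).
Proof. exact: (wedge_filtration_gwedges [:: i]). Qed.

Lemma wedge_filtration_trunc r d w : wedge_filtration r w -> wedge_filtration r (trunc d w).
Proof.
move=> [c ->]; exists (fun S => trunc (d - r) (c S)).
rewrite linear_sum; apply: eq_bigr => S /eqP cS.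
by rewrite /= trunc_gwedges -cardE cS.
Qed.

Lemma wedge_filtrationS r w : wedge_filtration r.+1 w -> wedge_filtration 1 w.
Proof.
move=> [d ->]; apply: wedge_filtration_sum => S /eqP.
rewrite /set_wedge cardE; case: (enum S) => [//|i l] _.
exact: wedge_filtration1_wedge.
Qed.

Lemma gwedges_all_filtration w : wedge_filtration 1 w -> gwedges (enum 'I_k) w = 0.
Proof.
move=> [d ->]; rewrite linear_sum big1 // => S; rewrite /set_wedge cardE.
case: (enum S) => [//|i l] _ /=; have := gwedge_gwedges i (enum 'I_k) (gwedges l (d S)).
rewrite gwedges_dup ?mem_enum // => /esym/(congr1 ( *:%R ((-1) ^+ size (enum 'I_k)))).
by rewrite scalerA -expr2 sqrr_sign scale1r scaler0.
Qed.

(* y comes from the adjugate of a k x k submatrix of determinant a (cramer_vectors). *)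
Section Cramer.
Variables (K : A -> Prop) (hK : ideal_pred K) (a : A) (y : 'I_k -> N).
Hypothesis ty : forall i j, t i (y j) = a *+ (i == j).

(** Up to a form divisible by [t i], [a *: w] is the contraction of [t i /\ w] with [y i], and this
    contraction is killed modulo [K] by the remaining factors; each factor costs one power of
    [a]. *)
Lemma cramer_kernel l w : uniq l -> gform_in K (gwedges l w) ->
  exists2 u, wedge_filtration 1 u & gform_in K (a ^+ size l *: w - u).
Proof.
elim: l w => [|i l IH] w /=.
  by move=> _ hw; exists 0; [exact: wedge_filtration0 | rewrite subr0 scale1r].
move=> /andP[il ul] hw; pose w' := gwedge (t i) (gcontract (y i) w).
(* Every [t j] with [j] in [l] vanishes on [y i]; the signs from passing the contraction and [t i]
   cancel. *)
have ew' : gwedges l w' = gwedge (t i) (gcontract (y i) (gwedges l w)).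
  rewrite /w'; elim: l il {IH ul hw} => [//|j l IH] /=.
  rewrite inE negb_or => /andP[ij /IH ->].
  rewrite gcontract_gwedge ty eq_sym (negPf ij) scale0r sub0r linearN /=.
  exact: gwedge_anticomm.
have [|u Fu hu] := IH (a *: w - w') ul.
  rewrite linearB linearZ /= ew'; have := gform_in_contract (y i) hw.
  by rewrite gcontract_gwedge ty eqxx.
exists (a ^+ size l *: w' + u).
  exact/wedge_filtrationD/Fu/wedge_filtrationZ/wedge_filtration1_wedge.
by move: hu; rewrite scalerBr scalerA -exprSr opprD addrA.
Qed.

(** Contracting [t i /\ w] with [y i] gives [a *: w = t i /\ (y i contracted into w)] modulo [K].
    The contracted form is still killed by the other [t j], as these vanish on [y i]. *)
Lemma cramer_division l w : uniq l ->
  (forall i, i \in l -> gform_in K (gwedge (t i) w)) ->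
  exists u, gform_in K (a ^+ size l *: w - gwedges l u).
Proof.
elim: l w => [|i l IH] w /=.
  by move=> _ _; exists w; rewrite scale1r subrr; apply: gform_in0.
move=> /andP[il ul] hw.
have [|u hu] := IH (gcontract (y i) w) ul.
  move=> j jl; have jil : j \in i :: l by rewrite inE jl orbT.
  have := gform_in_contract (y i) (hw j jil).
  rewrite gcontract_gwedge ty; have [ji|_] := eqVneq j i; first by rewrite -ji jl in il.
  by rewrite scale0r sub0r => /(gform_inN hK); rewrite opprK.
exists u; rewrite (_ : _ - _ =
    a ^+ size l *: gcontract (y i) (gwedge (t i) w) +
    gwedge (t i) (a ^+ size l *: gcontract (y i) w - gwedges l u)).
  apply: gform_inD => //; last exact: gform_in_wedge.
  by apply: (gform_inZ hK); apply: gform_in_contract; apply: hw; apply: mem_head.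
rewrite gcontract_gwedge ty eqxx [gwedge _ (_ - _)]linearB /= [gwedge _ (_ *: _)]linearZ /=.
rewrite scalerBr scalerA -exprSr.
by rewrite addrA subrK.
Qed.

End Cramer.
End Products.

(** * Division by decomposable forms *)

Section Coefficients.
Variables (A : comNzRingType) (N : lmodType A).
Local Notation gform := (gform N).

Lemma wedges_det k (t : 'I_k -> {linear N -> A^o}) (v : 'I_(k + 0) -> N) :
  wedges t (const_form N 1) v = \det (\matrix_(i, j) (t i (v (lshift 0 j)) : A)).
Proof.
elim: k t v => [|k IH] t v; first by rewrite det_mx00.
rewrite (expand_det_row _ ord0) /= /wedge_fun (reindex (@lshift k.+1 0)) /=; last first.
  by apply: onW_bij; exists (cast_ord (addn0 k.+1)) => i; apply: val_inj.
apply: eq_bigr => j _; rewrite mxE IH /cofactor [X in X * _]mulrC -mulrA; congr (_ * (_ * _)).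
congr (\det _); apply/matrixP => i l; rewrite !mxE /=; congr (t _ (v _)).
exact: val_inj.
Qed.

Lemma cramer_vectors k (t : 'I_k -> {linear N -> A^o}) (v : 'I_(k + 0) -> N) :
  exists y : 'I_k -> N,
    forall i j, t i (y j) = wedges t (const_form N 1) v *+ (i == j) :> A.
Proof.
rewrite wedges_det; set M := \matrix_(_, _) _.
exists (fun j => \sum_l (\adj M) l j *: v (lshift 0 l)) => i j.
have /matrixP/(_ i j) := mul_mx_adj M; rewrite [LHS]mxE [RHS]mxE => <-.
by rewrite linear_sum; apply: eq_bigr => l _; rewrite linearZ [M _ _]mxE /= mulrC.
Qed.

Lemma gwedges_enum k (t : 'I_k -> {linear N -> A^o}) (w : gform) q :
  gwedges t (enum 'I_k) w (k + q) = wedges t (w q).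
Proof.
elim: k t => [|k IH] t; first by rewrite (size0nil (size_enum_ord 0)).
by rewrite enum_ordSl /= /gwedges foldr_map; congr wedge; apply: IH.
Qed.

(** * Division by the full product, with and without a power of a minor *)

Section Division.
Variables (m : nat) (e : 'I_m -> N) (he : is_basis e).
Variables (k : nat) (t : 'I_k -> {linear N -> A^o}).
Local Notation theta := (gwedges t (enum 'I_k)).
Local Notation J := (coef_ideal e (wedges t (const_form N 1))).

(** The multipliers [b] that work for all [K] form an ideal [G] containing the [k]-th power of each
    minor, hence a fixed power of every element of [J]. Since [n] does not depend on [K], it
    survives enlarging [K]. *)
Lemma coef_ideal_exponent : exists n, forall a, J a -> forall K, ideal_pred K ->
  (forall w, gform_in K (theta w) ->
     exists2 u, wedge_filtration t 1 u & gform_in K (a ^+ n *: w - u)) /\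
  (forall w, (forall i, gform_in K (gwedge (t i) w)) ->
     exists u, gform_in K (a ^+ n *: w - theta u)).
Proof.
pose G b := forall K, ideal_pred K ->
  (forall w, gform_in K (theta w) ->
     exists2 u, wedge_filtration t 1 u & gform_in K (b *: w - u)) /\
  (forall w, (forall i, gform_in K (gwedge (t i) w)) ->
     exists u, gform_in K (b *: w - theta u)).
apply: (@ideal_radical_gen _ G _ _ k).
  split=> [K hK|b c hb hc K hK|b c hc K hK].
  - split=> w _; exists 0.
    + exact: wedge_filtration0.
    + by rewrite scale0r subr0; apply: gform_in0.
    + by rewrite scale0r linear0 subr0; apply: gform_in0.
  - have [hb1 hb2] := hb K hK; have [hc1 hc2] := hc K hK.
    split=> w hw.
      have [u Fu hu] := hb1 w hw; have [v Fv hv] := hc1 w hw.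
      exists (u + v); first exact: wedge_filtrationD.
      by rewrite scalerDl opprD addrACA; apply: gform_inD.
    have [u hu] := hb2 w hw; have [v hv] := hc2 w hw.
    by exists (u + v); rewrite linearD scalerDl opprD addrACA; apply: gform_inD.
  - have [hc1 hc2] := hc K hK; split=> w hw.
      have [u Fu hu] := hc1 w hw; exists (b *: u); first exact: wedge_filtrationZ.
      by rewrite -scalerA -scalerBr; apply: gform_inZ.
    have [u hu] := hc2 w hw; exists (b *: u).
    by rewrite linearZ -scalerA -scalerBr; apply: gform_inZ.
move=> s K hK; have [y ty] := cramer_vectors t (fun i => e (val s i)).
have h1 w := @cramer_kernel _ _ _ t K _ y ty _ w (enum_uniq 'I_k).
have h2 w := @cramer_division _ _ _ t K hK _ y ty _ w (enum_uniq 'I_k).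
rewrite size_enum_ord in h1 h2; split=> [w|w hw]; first exact: h1.
by apply: h2 => i _.
Qed.

(* Saito's division lemma, modulo K and in degrees < d. Once b w lies in the  *)
(* first step of the filtration, for a non-zero-divisor b modulo K, the       *)
(* induction hypothesis modulo K + (b) for the coefficients of b w moves it   *)
(* down the filtration, which vanishes in degrees < d after d steps.          *)
Lemma saito_division d K (s : seq A) w : ideal_pred K -> (forall a, a \in s -> J a) ->
  regular_mod K s -> (d <= size s)%N -> trunc d w = w -> gform_in K (theta w) ->
  exists2 u, wedge_filtration t 1 u & gform_in K (w - u).
Proof.
have [n hn] := coef_ideal_exponent.
elim/ltn_ind: d K s w => -[_|d IH] K s w hK Js rs ds.
  rewrite trunc0 => <- _; exists 0; first exact: wedge_filtration0.
  by rewrite subr0; apply: gform_in0.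
case: s => [//|a s] in Js rs ds * => trw hw.
have [na ra] := rs; have Ja := Js a (mem_head _ _).
have nb := nzd_modX (n := n) na; have rb := regular_mod_adjoinX n hK na ra.
have [u Fu hu] := (hn a Ja K hK).1 w hw.
set b := a ^+ n in nb rb hu *.
(* [r.+1] is the filtration step reached by [b *: v], and [r'] bounds the number of descents
   left. *)
suff down r r' v : (d < r + r')%N -> trunc d.+1 v = v ->
    (exists2 u, wedge_filtration t r.+1 u & gform_in K (b *: v - u)) ->
    exists2 u, wedge_filtration t 1 u & gform_in K (v - u).
  by apply: (down 0 d.+1) => //; exists u.
elim: r' r v {w u trw hw Fu hu} => [|r' IHr] r v.
  (* More than [d] linear factors leave nothing in degrees at most [d], so [b *: v] lies in [K] and
     [b] cancels. *)
  rewrite addn0 => dr trv [u [c ->] hu]; exists 0; first exact: wedge_filtration0.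
  rewrite subr0; apply: (gform_in_nzd nb).
  have := gform_in_trunc hK d.+1 hu; rewrite linearB linearZ /= trv linear_sum big1 ?subr0 //.
  move=> S /eqP cS; rewrite /set_wedge /= trunc_gwedges -cardE cS.
  by rewrite (_ : (_ - _)%N = 0) ?trunc0 ?linear0 //; apply/eqP; rewrite subn_eq0 ltnW.
move=> drr trv [u [c0 ->] hu].
pose c S := trunc (d.+1 - r.+1) (c0 S).
have {hu}hu : gform_in K (b *: v - \sum_(S : {set 'I_k} | #|S| == r.+1) set_wedge t S (c S)).
  have := gform_in_trunc hK d.+1 hu; rewrite linearB linearZ /= trv.
  congr (gform_in K (_ - _)); rewrite linear_sum; apply: eq_bigr => S /eqP cS.
  by rewrite /set_wedge /= trunc_gwedges -cardE cS.
have step (S : {set 'I_k}) : #|S| = r.+1 -> exists z x : gform,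
    [/\ wedge_filtration t 1 z, trunc (d.+1 - r.+1) x = x &
        gform_in K (c S - (z + b *: x))].
  move=> cS.
  (* Wedging with the product over the complement of [S] turns the sum into theta [/\ c S] up to
     sign, and the left side is a multiple of [b]. *)
  have hc : gform_in (adjoin1 K b) (theta (c S)).
    have [sg hsg] := set_wedge_complement_id t S.
    have := gform_in_gwedges t (enum (~: S)) hK hu.
    rewrite linearB linearZ linear_sum /= (bigD1 S) ?cS //= big1 ?addr0; last first.
      by move=> S' /andP[/eqP cS' neS]; rewrite -/(set_wedge t (~: S) _) set_wedge_complement ?cS.
    rewrite -/(set_wedge t (~: S) (set_wedge t S (c S))) hsg => h q x.
    have /(idealM hK ((-1) ^+ sg)) := h q x.
    rewrite gformDE gformNE !gformZE formDE formNE !formZE => {}h.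
    apply/adjoin1P; eexists; move: (idealN hK h).
    rewrite mulrBr [X in _ - X]mulrA -expr2 sqrr_sign mul1r opprB.
    by rewrite mulrCA [b * _]mulrC; apply.
  have [z Fz hz] : exists2 z, wedge_filtration t 1 z & gform_in (adjoin1 K b) (c S - z).
    apply: (IH (d.+1 - r.+1)%N _ (adjoin1 K b) s) => //; last exact: trunc_trunc.
    - by rewrite subSS ltnS leq_subr.
    - exact: adjoin1_ideal.
    - by move=> a' sa'; apply: Js; rewrite inE sa' orbT.
    - by rewrite subSS (leq_trans (leq_subr _ _)).
  have [x hx] := gform_adjoin1 he hK hz.
  exists (trunc (d.+1 - r.+1) z), (trunc (d.+1 - r.+1) x); split.
  - exact: wedge_filtration_trunc.
  - exact: trunc_trunc.
  - have := gform_in_trunc hK (d.+1 - r.+1) hx.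
    by rewrite !linearB linearZ /= trunc_trunc // opprD addrA.
have /choice[z /choice[x zxP]] (S : {set 'I_k}) : exists z x : gform, #|S| = r.+1 ->
    [/\ wedge_filtration t 1 z, trunc (d.+1 - r.+1) x = x &
        gform_in K (c S - (z + b *: x))].
  have [/step[z [x h]]|neS] := eqVneq #|S| r.+1; first by exists z, x.
  by exists 0, 0 => cS; rewrite cS eqxx in neS.
(* [b *: (v - y)] is the sum of the [set_wedge t S (z S)] modulo [K]; each [z S] supplies one more
   linear factor, so the filtration step rises by one. *)
pose y := \sum_(S : {set 'I_k} | #|S| == r.+1) set_wedge t S (x S).
have Fy : wedge_filtration t 1 y by apply: (@wedge_filtrationS _ _ _ _ r); exists x.
have [|||u' Fu' hu'] := IHr r.+1 (v - y); rewrite ?addSnnS //.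
- rewrite linearB /= trv linear_sum; congr (_ - _); apply: eq_bigr => S /eqP cS.
  by rewrite /set_wedge /= trunc_gwedges -cardE cS; have [_ -> _] := zxP S cS.
- exists (\sum_(S : {set 'I_k} | #|S| == r.+1) set_wedge t S (z S)).
    apply: wedge_filtration_sum => S /eqP cS; have [[f ->] _ _] := zxP S cS.
    rewrite linear_sum; apply: wedge_filtration_sum => S' /eqP cS'.
    rewrite /= /set_wedge -gwedges_cat.
    have := wedge_filtration_gwedges t (enum S ++ enum S') (f S').
    by rewrite size_cat -!cardE cS cS' addn1.
  rewrite (_ : _ - _ = b *: v - \sum_(S : {set 'I_k} | #|S| == r.+1) set_wedge t S (c S)
      + \sum_(S : {set 'I_k} | #|S| == r.+1) set_wedge t S (c S - (z S + b *: x S))).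
    apply: gform_inD => //; apply: gform_in_sum => // S /eqP cS.
    by apply: gform_in_gwedges => //; have [_ _] := zxP S cS.
  rewrite scalerBr scaler_sumr -!addrA; congr (_ + _).
  rewrite -!sumrN -!big_split; apply: eq_bigr => S _.
  by rewrite linearB linearD /= [set_wedge t S (b *: _)]linearZ /= addKr opprD addrC.
exists (y + u'); first exact: wedge_filtrationD.
by rewrite opprD addrA.
Qed.

(** The first element of [s] provides the multiplier [b]; the remaining [p.+1] serve
    [saito_division] on a quotient form of degree at most [p], modulo [K + (b)]. The part of that
    form in the ideal of the [t i] is killed by theta, and [b] cancels. *)
Lemma wedge_division p K s w : ideal_pred K -> (forall a, a \in s -> J a) ->
  regular_mod K s -> (p.+2 <= size s)%N -> trunc (k + p).+1 w = w ->
  (forall i, gform_in K (gwedge (t i) w)) -> exists u, gform_in K (w - theta u).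
Proof.
move=> hK; case: s => [//|a s] Js rs ps trw hw.
have [n hn] := coef_ideal_exponent; have [na ra] := rs.
have nb := nzd_modX (n := n) na; have rb := regular_mod_adjoinX n hK na ra.
have [g0 hg0] := (hn a (Js a (mem_head _ _)) K hK).2 w hw.
set b := a ^+ n in nb rb hg0; pose g := trunc p.+1 g0.
have hg : gform_in K (b *: w - theta g).
  have := gform_in_trunc hK (k + p).+1 hg0.
  rewrite linearB linearZ /= trw trunc_gwedges size_enum_ord.
  by rewrite -addnS addKn.
have [z Fz hz] : exists2 z, wedge_filtration t 1 z & gform_in (adjoin1 K b) (g - z).
  apply: (@saito_division p.+1 _ s) => //; [exact: adjoin1_ideal | | exact: trunc_trunc |].
    by move=> a' sa'; apply: Js; rewrite inE sa' orbT.
  move=> q v; apply/adjoin1P; exists (w q v).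
  by rewrite -opprB mulrC; apply: idealN => //; apply: hg.
have [u hu] := gform_adjoin1 he hK hz; exists u; apply: (gform_in_nzd nb).
rewrite (_ : _ *: _ = (b *: w - theta g) + theta (g - z - b *: u)).
  by apply: gform_inD => //; apply: gform_in_gwedges.
have -> : theta (g - z - b *: u) = theta g - b *: theta u.
  by rewrite !linearB linearZ /= (gwedges_all_filtration Fz) subr0.
by rewrite scalerBr addrA subrK.
Qed.

End Division.
End Coefficients.

(** * Localization and logarithmic forms *)

Section HomogeneousForms.
Variables (A : comNzRingType) (N : lmodType A).
Local Notation gform := (gform N).

Definition of_form p (w : extform N p) : gform :=
  fun q => if @eqP _ p q is ReflectT e then cast_form e w else 0.

Lemma of_form_id p (w : extform N p) : of_form w p = w.
Proof. by rewrite /of_form; case: eqP => // e; rewrite (eq_axiomK e). Qed.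

Lemma of_form_ne p (w : extform N p) q : p <> q -> of_form w q = 0.
Proof. by rewrite /of_form; case: eqP. Qed.

Lemma gform_in_of_form K p (w : extform N p) : ideal_pred K ->
  (forall v, K (w v)) -> gform_in K (of_form w).
Proof.
move=> hK hw q v; have [e|ne] := pselect (p = q); first by subst q; rewrite of_form_id.
by rewrite of_form_ne //; apply: ideal0.
Qed.

Lemma trunc_of_form p d (w : extform N p) : (p < d)%N -> trunc d (of_form w) = of_form w.
Proof.
move=> pd; apply: gformP => q; rewrite /trunc; case: ltnP => // dq.
by rewrite of_form_ne // => pq; rewrite -pq leqNgt pd in dq.
Qed.

Lemma wedgeZ p (t : {linear N -> A^o}) a (w : extform N p) :
  wedge t (a *: w) = a *: wedge t w.
Proof.
apply: form_ext => v; rewrite formZE /= /wedge_fun mulr_sumr.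
by apply: eq_bigr => i _; rewrite formZE mulrCA.
Qed.

Lemma gwedge_of_form p (t : {linear N -> A^o}) (w : extform N p) :
  gwedge t (of_form w) = of_form (wedge t w).
Proof.
apply: gformP => -[|q] /=; first by rewrite of_form_ne.
have [e|ne] := pselect (p = q); first by subst q; rewrite !of_form_id.
by rewrite !of_form_ne ?wedge0r // => -[].
Qed.

Lemma form_gens m (e : 'I_m -> N) (T : finType) (g : T -> A) q (w : extform N q) :
  is_basis e -> (forall v, in_gen g (w v)) ->
  exists u : T -> extform N q, w = \sum_t g t *: u t.
Proof.
move=> he hw; pose K (x : A) := x = 0.
have hK : ideal_pred K by split=> [//|x y -> ->|a x ->]; [exact: addr0 | exact: mulr0].
have [|u hu] := @gform_adjoin _ _ _ _ he K _ g (of_form w) hK.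
  apply: gform_in_of_form; first exact: adjoin_ideal.
  by move=> v; have [c ->] := hw v; exists c; apply: subrr.
exists (fun t => u t q); apply: form_ext => v; apply/eqP; rewrite -subr_eq0.
apply/eqP; have := hu q v.
by rewrite gformDE gformNE gform_sumE of_form_id formDE formNE !form_sumE.
Qed.

Lemma cast_formE q q' (eq : q = q') (w : gform) : cast_form eq (w q) = w q'.
Proof. by case: _ / eq. Qed.
Lemma cast_formZ q q' (eq : q = q') a (w : extform N q) :
  cast_form eq (a *: w) = a *: cast_form eq w.
Proof. by case: _ / eq. Qed.
Lemma cast_form_eqP q q' (eq : q = q') (K : A -> Prop) (w1 w2 : extform N q) :
  (forall v, K (w1 v - w2 v)) -> forall v, K (cast_form eq w1 v - cast_form eq w2 v).
Proof. by case: _ / eq. Qed.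

Lemma wedges_scale k q (s t : 'I_k -> {linear N -> A^o}) (c : 'I_k -> A) (w : extform N q) :
  (forall i x, s i x = c i * t i x :> A) -> wedges s w = (\prod_i c i) *: wedges t w.
Proof.
elim: k s t c => [|k IH] s t c hst; first by rewrite big_ord0 scale1r.
rewrite /= (IH _ (fun i => t (lift ord0 i)) (fun i => c (lift ord0 i))) //.
apply: form_ext => v; rewrite big_ord_recl formZE /= /wedge_fun mulr_sumr.
by apply: eq_bigr => i _; rewrite formZE hst; ring.
Qed.

Lemma wedges_congr (K : A -> Prop) k q (s t : 'I_k -> {linear N -> A^o}) (w : extform N q) :
  ideal_pred K -> (forall i x, K ((s i x : A) - t i x)) ->
  forall v, K (wedges s w v - wedges t w v).
Proof.
move=> hK; elim: k s t => [|k IH] s t hst v; first by rewrite subrr; apply: ideal0.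
rewrite /= /wedge_fun -sumrB; apply: (ideal_sum hK) => i _.
set x := wedges _ _ _; set y := wedges _ _ _.
rewrite (_ : _ - _ = (-1) ^+ i * x * ((s ord0 (v i) : A) - t ord0 (v i)) +
    (-1) ^+ i * (t ord0 (v i) : A) * (x - y)); last by ring.
by apply: idealD => //; apply: idealM => //; apply: IH.
Qed.

(** Factor [j] returns to its place by passing [j] others. *)
Lemma wedge_wedges_lift k q (t : 'I_k.+1 -> {linear N -> A^o}) j (w : extform N q) :
  wedge (t j) (wedges (fun i => t (lift j i)) w) = (-1) ^+ j *: wedges t w.
Proof.
elim: k t j => [|k IH] t j; first by rewrite ord1 scale1r.
case: (unliftP ord0 j) => [i ->|->]; last by rewrite scale1r.
have sw s1 s2 p (u : extform N p) : wedge s1 (wedge s2 u) = - wedge s2 (wedge s1 u).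
  have := congr1 (fun g : gform => g p.+2) (gwedge_anticomm s1 s2 (of_form u)).
  by rewrite !gwedge_of_form gformNE !of_form_id.
rewrite /= sw (_ : lift (lift ord0 i) ord0 = ord0); last exact: val_inj.
have := IH (fun i => t (lift ord0 i)) i.
rewrite (_ : (fun j => t (lift ord0 (lift i j))) =
  (fun j => t (lift (lift ord0 i) (lift ord0 j)))).
  by move=> ->; rewrite wedgeZ -scaleNr /bump leq0n exprS mulN1r.
apply: funext => l; congr t; apply: val_inj.
by rewrite /= /bump !leq0n !add1n ltnS addnS.
Qed.

Lemma wedges_perm k q (t : 'I_k -> {linear N -> A^o}) (s : 'S_k) (w : extform N q) :
  wedges (fun i => t (s i)) w = (-1) ^+ s *: wedges t w.
Proof.
elim: k t s => [|k IH] t s.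
  by rewrite (_ : s = 1%g) ?odd_perm1 ?scale1r //; apply/permP => -[].
have [j [s' ->]] : exists j (s' : 'S_k), s = lift_perm ord0 j s'.
  exists (s ord0).
  pose f (i : 'I_k) := odflt i (unlift (s ord0) (s (lift ord0 i))).
  have fE (i : 'I_k) : lift (s ord0) (f i) = s (lift ord0 i).
    rewrite /f; case: unliftP => [//|/perm_inj/eqP].
    by rewrite eq_sym (negPf (neq_lift _ _)).
  have f_inj : injective f.
    by move=> x y exy; apply: (@lift_inj _ ord0); apply: (@perm_inj _ s); rewrite -!fE exy.
  exists (perm f_inj); apply/permP => i; case: (unliftP ord0 i) => [l ->|->].
    by rewrite lift_perm_lift permE fE.
  by rewrite lift_perm_id.
rewrite /= lift_perm_id.
rewrite (_ : (fun i => t _) = fun i => t (lift j (s' i))); last first.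
  by apply: funext => i; rewrite lift_perm_lift.
rewrite (IH (fun i => t (lift j i))) wedgeZ wedge_wedges_lift scalerA.
by rewrite odd_lift_perm /= signr_addb signr_odd mulrC.
Qed.

(** Every term of the expansion contains some [t i (x j)]. *)
Lemma wedge_filtration_eval K k (t : 'I_k -> {linear N -> A^o}) (w : gform) q
    (x : 'I_q -> N) : ideal_pred K -> (forall i j, K (t i (x j) : A)) ->
  wedge_filtration t 1 w -> K (w q x).
Proof.
move=> hK hx [d ->]; rewrite gform_sumE form_sumE; apply: (ideal_sum hK) => S.
rewrite /set_wedge cardE; case: (enum S) => [//|i l] _.
case: q x hx => [|q] x hx /=; first exact: ideal0.
by apply: (ideal_sum hK) => j _; apply/(idealMl hK)/(idealM hK).
Qed.

End HomogeneousForms.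

Section LocalForms.
Variables (A : comNzRingType) (N : lmodType A).

Lemma loc_formD q (w1 w2 : extform N q) : loc_form (w1 + w2) = loc_form w1 + loc_form w2.
Proof. by apply: form_ext => v; rewrite formDE /= /loc_form_fun /mkfrac mklocDl. Qed.

Lemma mkfracZ (a x : A) s : mkfrac (a * x) s = frac_embed a * mkfrac x s.
Proof. by rewrite !mkfracE rmorphM mulrA. Qed.

Lemma loc_formZ q a (w : extform N q) : loc_form (a *: w) = frac_embed a *: loc_form w.
Proof. by apply: form_ext => v; rewrite formZE /= /loc_form_fun formZE mkfracZ. Qed.

Lemma loc_form0 q : loc_form (0 : extform N q) = 0.
Proof. by rewrite -(scale0r (0 : extform N q)) loc_formZ rmorph0 scale0r. Qed.

Lemma loc_form_sum q I (r : seq I) (P : pred I) (F : I -> extform N q) :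
  loc_form (\sum_(i <- r | P i) F i) = \sum_(i <- r | P i) loc_form (F i).
Proof. exact: (big_morph _ (@loc_formD q) (loc_form0 q)). Qed.

Lemma loc_form_inj q : injective (@loc_form A N q).
Proof.
move=> w1 w2 e; apply: form_ext => v.
have := congr1 (fun w : extform _ q => w (fun i => mkloc (v i) (one_nzd A))) e.
rewrite /= !loc_form_funE => /mkfrac_eqP.
by rewrite prod_nzdE big1 ?mulr1.
Qed.

Lemma loc_form_wedge q (t : {linear N -> A^o}) (w : extform N q) :
  loc_form (wedge t w) = wedge (loc_lin t) (loc_form w).
Proof.
apply: form_ext => v; rewrite /= /loc_form_fun /= /wedge_fun mkfracE rmorph_sum mulr_suml.
apply: eq_bigr => i _; rewrite !rmorphM rmorphXn rmorphN1 -!mulrA; congr (_ * _).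
rewrite /= /loc_lin_fun /loc_form_fun [RHS]mkfracM [RHS]mkfracE.
rewrite [frac_embed (_ * w _)]rmorphM -mulrA /=.
congr (_ * (_ * (frac_embed _)^-1)).
by rewrite !prod_nzdE (bigD1_ord i).
Qed.

Lemma loc_form_wedges k q (t : 'I_k -> {linear N -> A^o}) (w : extform N q) :
  loc_form (wedges t w) = wedges (fun i => loc_lin (t i)) (loc_form w).
Proof. by elim: k t => [//|k IH] t; rewrite /= loc_form_wedge IH. Qed.

Lemma loc_form_cast q q' (eq : q = q') (w : extform N q) :
  loc_form (cast_form eq w) = cast_form eq (loc_form w).
Proof. by case: _ / eq. Qed.

End LocalForms.

Section LogForms.
Variables (R : comNzRingType) (k p : nat) (f : 'I_k -> R).
Local Notation M := (Der R).
Local Notation F := (\prod_i f i).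
Local Notation df := (fun i => differential (f i)).
Hypothesis nF : nzd F.

Lemma nzd_factor i : nzd (f i).
Proof. by move=> x fx; apply: nF; rewrite (bigD1 i) //= mulrAC fx mul0r. Qed.

Lemma cofactor_form_div q (xi : extform M q) i :
  form_div xi (cofactor_prod f i) = form_div (f i *: xi) F.
Proof.
have uF := frac_embed_unit nF; have ui := frac_embed_unit (@nzd_factor i).
move: uF; rewrite /form_div (bigD1 i) //= -/(cofactor_prod f i) rmorphM => uF.
have uc : frac_embed (cofactor_prod f i) \is a GRing.unit.
  by move: uF; rewrite unitrM => /andP[].
by rewrite loc_formZ scalerA invrM // divrK.
Qed.

Lemma form_div_inj q : injective (fun w : extform M q => form_div w F).
Proof.
move=> w1 w2 /(congr1 ( *:%R (frac_embed F))).
by rewrite !scalerA divrr ?frac_embed_unit // !scale1r => /loc_form_inj.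
Qed.

Lemma form_divD q (w1 w2 : extform M q) : form_div (w1 + w2) F = form_div w1 F + form_div w2 F.
Proof. by rewrite /form_div loc_formD scalerDr. Qed.

Lemma form_div_sum q (xi : 'I_k -> extform M q) :
  \sum_i form_div (xi i) (cofactor_prod f i) = form_div (\sum_i f i *: xi i) F.
Proof.
rewrite /form_div loc_form_sum scaler_sumr; apply: eq_bigr => i _.
exact: cofactor_form_div.
Qed.

Lemma wedges_dlog q (g : extform M q) :
  wedges (fun i => dlog (f i)) (loc_form g) = form_div (wedges df g) F.
Proof.
rewrite /form_div loc_form_wedges.
rewrite (@wedges_scale _ _ _ _ _ (fun i => loc_lin (df i)) (fun i => (frac_embed (f i))^-1)) //.
congr (_ *: _); apply: (mulIr (frac_embed_unit nF)).
rewrite mulVr ?frac_embed_unit // rmorph_prod -big_split big1 // => i _ /=.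
by rewrite mulVr // frac_embed_unit //; apply: nzd_factor.
Qed.

Variables (omega : extform (localized M) p) (eta : extform M p).
Hypothesis omegaE : omega = form_div eta F.

Lemma LRP (hkp : (k <= p)%N) b (g : extform M (p - k)) : LR hkp f b omega g <->
  exists xi : 'I_k -> extform M p,
    b *: eta = cast_form (subnKC hkp) (wedges df g) + \sum_i f i *: xi i.
Proof.
have E (xi : 'I_k -> extform M p) :
    cast_form (subnKC hkp) (wedges (fun i => dlog (f i)) (loc_form g)) +
      \sum_i form_div (xi i) (cofactor_prod f i) =
    form_div (cast_form (subnKC hkp) (wedges df g) + \sum_i f i *: xi i) F.
  by rewrite form_div_sum form_divD wedges_dlog /form_div cast_formZ loc_form_cast.
have Eb : frac_embed b *: omega = form_div (b *: eta) F.
  by rewrite omegaE /form_div loc_formZ !scalerA mulrC.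
split=> -[xi h]; exists xi; last by rewrite Eb E h.
by apply: form_div_inj; rewrite -E -h -Eb.
Qed.

Lemma log_conditionP : log_condition f omega ->
  forall i, exists zeta : 'I_k -> extform M p.+1, wedge (df i) eta = \sum_j f j *: zeta j.
Proof.
move=> h i; have [zeta hz] := h i; exists zeta.
apply: form_div_inj; rewrite -form_div_sum -hz omegaE /form_div wedgeZ.
by rewrite loc_form_wedge.
Qed.

End LogForms.

(** * Reduction modulo the divisor ideal *)

Section QuotientRing.
Variables (R : comNzRingType) (I : idealr R).
Local Notation B := {ideal_quot I}.
Local Notation K := (fun x : R => is_true (x \in (I : {pred R}))).

Lemma mem_ideal_pred : ideal_pred K.
Proof.
by split=> [|x y|a x]; [exact: rpred0 | exact: rpredD | exact: idealMr].
Qed.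

Fact mkres_zmod : zmod_morphism (mkres I).
Proof. by move=> x y; exact: (rmorphB (\pi_B%qT)). Qed.
HB.instance Definition _ := GRing.isZmodMorphism.Build R B (mkres I) mkres_zmod.
Fact mkres_monoid : monoid_morphism (mkres I).
Proof. by split; [exact: mkres1 | exact: mkresM]. Qed.
HB.instance Definition _ := GRing.isMonoidMorphism.Build R B (mkres I) mkres_monoid.

Lemma mkres_eq0 x : mkres I x = 0 <-> K x.
Proof. by rewrite -(rmorph0 (mkres I)) mkres_eqP subr0. Qed.

Lemma nzd_mkres a : nzd (mkres I a) <-> nzd_mod K a.
Proof.
split=> h x.
  by move=> /mkres_eq0; rewrite mkresM => /h/mkres_eq0.
elim/res_ind: x => x; rewrite -mkresM => /mkres_eq0/h hx.
exact/mkres_eq0.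
Qed.

Lemma wedges_quot (N : lmodType R) k (t : 'I_k -> {linear N -> R^o}) (v : 'I_(k + 0) -> N) :
  wedges (fun i => quot_lin I (t i)) (const_form (quotmod I N) 1) (fun i => mkquot I (v i)) =
  mkres I (wedges t (const_form N 1) v).
Proof.
rewrite !wedges_det -det_map_mx; congr (\det _); apply/matrixP => i j.
by rewrite !mxE /= quot_lin_funE.
Qed.

Lemma coef_ideal_lift (N : lmodType R) m (e : 'I_m -> N) k (t : 'I_k -> {linear N -> R^o}) b :
  coef_ideal (fun i => mkquot I (e i))
    (wedges (fun i => quot_lin I (t i)) (const_form (quotmod I N) 1)) b ->
  exists2 a, coef_ideal e (wedges t (const_form N 1)) a & mkres I a = b.
Proof.
move=> [c ->].
exists (\sum_s rrep (c s) * wedges t (const_form N 1) (fun i => e (val s i))).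
  by exists (fun s => rrep (c s)).
rewrite rmorph_sum; apply: eq_bigr => s _.
by rewrite rmorphM /= rrepK wedges_quot.
Qed.

(** The ideals [K + (a_0, ..., a_(j-1))] are the preimages [Kn j] of the ideals generated by the
    [b_i], so cancellation transfers. *)
Lemma regular_seq_lift q (b : 'I_q -> B) (a : 'I_q -> R) :
  (forall i, mkres I (a i) = b i) -> regular_seq b -> regular_mod K [seq a i | i <- enum 'I_q].
Proof.
move=> ab [_ hb].
pose an n := if insub n is Some i then a i else 0.
have anE (i : 'I_q) : an i = a i by rewrite /an valK.
(* Coefficients indexed by [nat] keep one type for all [j]; [an] extends [a] by 0 for the same
   purpose. *)
pose Kn j x := exists c : nat -> B, mkres I x = \sum_(i < j) c i * mkres I (an i).
have Kn0 : K = Kn 0%N.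
  apply: funext => x; apply: propext; rewrite -(mkres_eq0 x) /Kn.
  split=> [->|[c]]; last by rewrite big_ord0.
  by exists (fun=> 0); rewrite big_ord0.
have KnS j : adjoin1 (Kn j) (an j) = Kn j.+1.
  apply: funext => x; apply: propext; split.
    move=> /adjoin1P[y [c hc]]; exists (fun i => if i == j then mkres I y else c i).
    rewrite big_ord_recr /= eqxx; apply/eqP; rewrite -subr_eq -mkresM -rmorphB /= hc.
    by apply/eqP/eq_bigr => i _; rewrite ltn_eqF.
  move=> [c]; rewrite big_ord_recr /= => /eqP; rewrite -subr_eq => /eqP hc.
  by apply/adjoin1P; exists (rrep (c j)), c; rewrite rmorphB rmorphM /= rrepK.
have KnP (i : 'I_q) x : Kn i x <->
    in_gen (fun j : 'I_i => b (widen_ord (ltnW (ltn_ord i)) j)) (mkres I x).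
  have anb (j : 'I_i) : mkres I (an j) = b (widen_ord (ltnW (ltn_ord i)) j).
    by rewrite -ab -anE.
  split=> -[c hc].
    by exists (fun j : 'I_i => c j); rewrite hc; apply: eq_bigr => j _; rewrite anb.
  exists (fun n => if insub n is Some j then c j else 0).
  by rewrite hc; apply: eq_bigr => j _; rewrite valK anb.
rewrite Kn0 (_ : map _ _ = [seq an n | n <- iota 0%N q]); last first.
  by rewrite -val_enum_ord -map_comp; apply: eq_map => i /=; rewrite anE.
have : (0 + q <= q)%N by [].
elim: {1 3}q 0%N => [//|r IH] j jrq; have jq : (j < q)%N.
  by apply: leq_trans jrq; rewrite addnS ltnS leq_addr.
split; last by rewrite -/(regular_mod _ _) KnS; apply: IH; rewrite addSnnS.
move=> x; rewrite -[j]/(val (Ordinal jq)) !KnP anE mkresM ab; exact: hb.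
Qed.

End QuotientRing.

(** * Uniqueness of the divisor and of the residue *)

Section Divisibility.
Variable A : comNzRingType.

Lemma in_gen1 (a x : A) : in_gen (fun _ : 'I_1 => a) x <-> divides a x.
Proof.
split=> [[c ->]|[c ->]]; first by exists (c ord0); rewrite big_ord1 mulrC.
by exists (fun=> c); rewrite big_ord1 mulrC.
Qed.

Lemma prime_divides_prod (T : finType) (a : A) (g : T -> A) : prime_elt a ->
  divides a (\prod_t g t) -> exists t, divides a (g t).
Proof.
move=> [_ na pa]; rewrite -big_enum; elim: (enum T) => [|t r IH].
  by rewrite big_nil => -[c e]; case: na; exists c.
by rewrite big_cons => /pa[h|/IH//]; exists t.
Qed.

Lemma invertible_prod (T : finType) (u : T -> A) :
  (forall t, invertible (u t)) -> invertible (\prod_t u t).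
Proof.
move=> hu; have [v hv] := choice hu; exists (\prod_t v t).
by rewrite -big_split big1 // => t _; apply: hv.
Qed.

Lemma associated_sym (a b : A) : associated a b -> associated b a.
Proof.
move=> [u [v uv] ->]; exists v; first by exists u; rewrite mulrC.
by rewrite mulrA [v * u]mulrC uv mul1r.
Qed.

Lemma associated_trans (a b c : A) : associated a b -> associated b c -> associated a c.
Proof.
move=> [u [u' hu] ->] [v [v' hv] ->]; exists (u * v); last by rewrite mulrA.
by exists (u' * v'); rewrite mulrACA hu hv mulr1.
Qed.

Lemma prime_divides_associated (a b : A) : prime_elt a -> prime_elt b -> nzd b ->
  divides a b -> associated b a.
Proof.
move=> [_ na _] [_ _ pb] nb [c e].
have [[d hd]|[d hd]] : divides b a \/ divides b c.
  by apply: pb; exists 1; rewrite mulr1.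
  exists c; last by rewrite mulrC.
  exists d; apply: subr0_eq; apply: nb; rewrite mulrBr mulr1 mulrCA.
  by rewrite -hd [c * _]mulrC -e subrr.
case: na; exists d; apply: subr0_eq; apply: nb.
by rewrite mulrBr mulr1 mulrCA -hd -e subrr.
Qed.

End Divisibility.
Lemma signed_cross_mul (A : comUnitRingType) (s : bool) (b b' g g' : A) :
  b \is a GRing.unit -> b' \is a GRing.unit ->
  b' * g = (-1) ^+ s * (b * g') -> b'^-1 * g' = (-1) ^+ s * b^-1 * g.
Proof.
move=> ub ub' h; apply: (mulrI ub'); rewrite mulrA divrr // mul1r.
by rewrite mulrCA h mulrACA -expr2 sqrr_sign mul1r mulKr.
Qed.

Lemma gwedges_eq0 (A : comNzRingType) (N : lmodType A) k (t : 'I_k -> {linear N -> A^o})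
    (l : seq 'I_k) (w : gform N) d :
  (forall q, (size l + q)%N = d -> w q = 0) -> gwedges t l w d = 0.
Proof.
elim: l d => [|i l IH] d hw; first exact: hw.
case: d hw => [//|d] hw /=; rewrite IH ?wedge0r // => q hq.
by apply: hw; rewrite /= addSn hq.
Qed.

Lemma form_divides (A : comNzRingType) (N : lmodType A) m (e : 'I_m -> N) q
    (w : extform N q) a : is_basis e ->
  (forall v, divides a (w v)) -> exists w' : extform N q, w = a *: w'.
Proof.
move=> he hw.
have [|u ->] := form_gens (g := fun _ : 'I_1 => a) (w := w) he.
  by move=> v; apply/in_gen1.
by exists (u ord0); rewrite big_ord1.
Qed.

Lemma cast_wedges (A : comNzRingType) (N : lmodType A) k p (hkp : (k <= p)%N)
    (t : 'I_k -> {linear N -> A^o}) (w : gform N) :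
  cast_form (subnKC hkp) (wedges t (w (p - k)%N)) = gwedges t (enum 'I_k) w p.
Proof. by rewrite -gwedges_enum cast_formE. Qed.

Lemma LR_mod (R : comNzRingType) k p (hkp : (k <= p)%N) (f : 'I_k -> R) (I : idealr R)
    (eta : extform (Der R) p) omega b gamma :
  (forall i, f i \in (I : {pred R})) -> nzd (\prod_i f i) ->
  omega = form_div eta (\prod_i f i) -> LR hkp f b omega gamma ->
  forall v, b * eta v -
    gwedges (fun i => differential (f i)) (enum 'I_k) (of_form gamma) p v \in (I : {pred R}).
Proof.
move=> fI nF eF /(LRP nF eF)[xi h] v; rewrite -formZE h -cast_wedges of_form_id.
rewrite formDE [_ + _ v]addrC addrK form_sumE; apply: rpred_sum => i _.
by rewrite formZE mulrC idealMr.
Qed.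

(** * The logarithmic representation and the residue of a reduced form *)

Section Main.
Variables (R : comNzRingType) (m : nat) (e : 'I_m -> Der R) (he : is_basis e).
Variables (k p : nat) (hkp : (k <= p)%N) (f : 'I_k -> R) (I : idealr R).
Hypothesis hI : forall x, x \in (I : {pred R}) <-> in_gen f x.
Local Notation M := (Der R).
Local Notation K := (fun x : R => is_true (x \in (I : {pred R}))).
Local Notation df := (fun i => differential (f i)).
Local Notation F := (\prod_i f i).

Lemma mem_factor i : K (f i).
Proof.
apply/hI; exists (fun j => (j == i)%:R).
by rewrite (bigD1 i) //= eqxx mul1r big1 ?addr0 // => j /negPf ->; rewrite mul0r.
Qed.

Section Division.
Variables (omega : extform (localized M) p) (eta : extform M p).
Hypotheses (nF : nzd F) (omegaE : omega = form_div eta F).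

(** The difference takes values in the ideal of the [f i]; [form_gens] splits it into [f i *: xi i]
    with forms [xi i]. *)
Lemma LR_of_division b u :
  gform_in K (b *: of_form eta - gwedges df (enum 'I_k) u) ->
  exists gamma : extform M (p - k), LR hkp f b omega gamma.
Proof.
move=> hu; exists (u (p - k)%N); apply/(LRP nF omegaE); rewrite cast_wedges.
have [|xi hxi] := form_gens (g := f) (w := b *: eta - gwedges df (enum 'I_k) u p) he.
  move=> v; apply/hI; have := hu p v.
  by rewrite gformDE gformNE gformZE of_form_id.
by exists xi; rewrite -hxi addrC subrK.
Qed.

Lemma log_condition_mod i : log_condition f omega ->
  gform_in K (gwedge (differential (f i)) (of_form eta)).
Proof.
move=> /(log_conditionP nF omegaE)/(_ i)[z hz]; rewrite gwedge_of_form.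
apply: gform_in_of_form => [|v]; first exact: mem_ideal_pred.
rewrite hz form_sumE; apply/hI; exists (fun j => z j v).
by apply: eq_bigr => j _; rewrite formZE mulrC.
Qed.

Lemma log_form_power : log_condition f omega ->
  exists n : nat, forall a : R, coef_ideal e (dwedge f) a ->
    exists gamma : extform M (p - k), LR hkp f (a ^+ n) omega gamma.
Proof.
move=> hlog; have [n hn] := coef_ideal_exponent e df; exists n => a Ja.
have [_ /(_ (of_form eta))[|u]] := hn a Ja K (mem_ideal_pred I).
  by move=> i; apply: log_condition_mod.
exact: LR_of_division.
Qed.

Lemma log_form_depth : log_condition f omega ->
  depth_ge (coef_ideal (fun i => mkquot I (e i)) (dwedge_bar I f)) (p - k + 2) ->
  exists gamma : extform M (p - k), LR hkp f 1 omega gamma.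
Proof.
move=> hlog; have hK := mem_ideal_pred I; case.
  (* Infinite depth: the coefficient ideal contains 1, so some [a] has class 1 and the multiplier
     [a ^+ n] is already 1 modulo [I]. *)
  move=> /coef_ideal_lift[a Ja a1]; have [n hn] := coef_ideal_exponent e df.
  have [_ /(_ (of_form eta))[|u hu]] := hn a Ja K hK.
    by move=> i; apply: log_condition_mod.
  apply: (@LR_of_division _ u); rewrite (_ : _ - _ =
    (1 - a ^+ n) *: of_form eta + (a ^+ n *: of_form eta - gwedges df (enum 'I_k) u)).
    apply: gform_inD => //; apply: gform_inZl => //.
    by apply/mkres_eqP; rewrite rmorphXn /= a1 expr1n mkres1.
  by rewrite scalerBl addrA subrK.
move=> [q [b [rb Jb dq]]].
have /choice[a ha] i : exists a, coef_ideal e (dwedge f) a /\ mkres I a = b i.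
  by have [a Ja ea] := coef_ideal_lift (Jb i); exists a.
have rs := regular_seq_lift (fun i => (ha i).2) rb.
have [|||i|u] := @wedge_division _ _ _ _ he _ df (p - k)%N _ _ (of_form eta) hK _ rs.
- by move=> x /mapP[i _ ->]; have [] := ha i.
- by rewrite size_map size_enum_ord; move: dq; rewrite addn2.
- by rewrite trunc_of_form // subnKC.
- exact: log_condition_mod.
by rewrite -[X in X - _]scale1r; apply: LR_of_division.
Qed.

End Division.

Lemma in_kernelP k' (g : 'I_k' -> R) (x : localized (quotmod I M)) :
  in_kernel I g x <-> forall i, K (qrep (lnum x) (g i)).
Proof.
split=> h i; have := h i; rewrite /= /loc_lin_fun /= /quot_lin_fun.
  by move=> /mkfrac_eqP; rewrite mul0r mulr1 => /mkres_eq0.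
by move=> /mkres_eq0 hi; apply/mkfrac_eqP; rewrite mul0r mulr1.
Qed.

(** Comparing numerators gives [F' *: eta = F *: eta']. As [eta] is not divisible by the prime
    [f i], some value of it is not, hence [f i] divides some [f' j]; both being prime, they are
    associated. *)
Lemma reduced_factor (omega : extform (localized M) p) (eta eta' : extform M p)
    k' (f' : 'I_k' -> R) :
  reduced_repr f omega eta -> reduced_repr f' omega eta' ->
  forall i, exists j, associated (f' j) (f i).
Proof.
move=> [pf _ df0 [nF _ _ _] eF] [pf' _ _ [nF' _ _ _] eF'] i.
have [v nv] : exists v, ~ divides (f i) (eta v).
  apply: contrapT => h; apply: (df0 i); apply: (form_divides he) => v.
  by apply: contrapT => nv; apply: h; exists v.
have E : (\prod_j f' j) *: eta = F *: eta'.
  apply: loc_form_inj; rewrite !loc_formZ.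
  have uF := frac_embed_unit nF; have uF' := frac_embed_unit nF'.
  have -> : loc_form eta = frac_embed F *: omega by rewrite eF scalerA divrr // scale1r.
  have -> : loc_form eta' = frac_embed (\prod_j f' j) *: omega.
    by rewrite eF' scalerA divrr // scale1r.
  by rewrite !scalerA mulrC.
have [_ _ pfi] := pf i.
have [|/(prime_divides_prod (pf i))[j hj]|//] := pfi (\prod_j f' j) (eta v).
  have := congr1 (fun w : extform M p => w v) E; rewrite !formZE (bigD1 i) //= => ->.
  by exists ((\prod_(j | j != i) f j) * eta' v); rewrite mulrA.
by exists j; apply: prime_divides_associated (nzd_factor nF' (i := j)) hj.
Qed.

Section Residue.
Variables (omega : extform (localized M) p) (eta eta' : extform M p) (f' : 'I_k -> R).
Hypotheses (nF : nzd F) (omegaE : omega = form_div eta F).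
Hypotheses (nF' : nzd (\prod_i f' i)) (omegaE' : omega = form_div eta' (\prod_i f' i)).
Variables (s : 'S_k) (u : 'I_k -> R).
Hypotheses (hu : forall i, invertible (u i)) (f'E : forall i, f' i = u i * f (s i)).

Lemma ideal_cancel_invertible a x : invertible a -> K (a * x) -> K x.
Proof.
move=> [b ab] /(idealM (mem_ideal_pred I) b).
by rewrite mulrA [b * a]mulrC ab mul1r.
Qed.

Lemma mem_associated_gens x : x \in (I : {pred R}) <-> in_gen f' x.
Proof.
rewrite hI; split=> -[c ->]; last first.
  apply/hI; apply: (ideal_sum (mem_ideal_pred I)) => i _; rewrite f'E.
  by do 2! apply: (idealM (mem_ideal_pred I)); apply: mem_factor.
have /choice[w hw] := hu; exists (fun i => c (s i) * w i).
rewrite (reindex_inj (@perm_inj _ s)); apply: eq_bigr => i _; rewrite f'E.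
by rewrite mulrA -[c _ * _ * _]mulrA [w i * _]mulrC hw mulr1.
Qed.

(** By the Leibniz rule the difference is [X (u i) * f (s i)], which lies in [I]. *)
Lemma der_associated (X : M) i : K (X (f' i) - u i * X (f (s i))).
Proof.
rewrite f'E derM addrK; apply: (idealM (mem_ideal_pred I)); exact: mem_factor.
Qed.

Lemma der_associated_mem (X : M) i : K (X (f' i)) <-> K (X (f (s i))).
Proof.
have hK := mem_ideal_pred I; split=> h; last first.
  rewrite -[X _](subrK (u i * X (f (s i)))).
  by apply: (idealD hK); [apply: der_associated | apply: (idealM hK)].
apply: (ideal_cancel_invertible (hu i)).
have /(idealB hK h) := der_associated X i.
by rewrite opprB addrC subrK.
Qed.

Lemma residue_unique a b b' gamma gamma' (v : 'I_(p - k) -> localized (quotmod I M)) :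
  coef_ideal e (dwedge f) a -> nzd (mkres I a) ->
  nzd (mkres I b) -> nzd (mkres I b') ->
  LR hkp f b omega gamma -> LR hkp f' b' omega gamma' ->
  (forall j, in_kernel I f (v j)) ->
  residue_form I b' gamma' v = (-1) ^+ s * residue_form I b gamma v.
Proof.
move=> Ja /nzd_mkres na nb nb' hLR hLR' hv; have hK := mem_ideal_pred I.
pose U := \prod_i u i; have iU : invertible U by apply: invertible_prod.
pose theta := gwedges df (enum 'I_k).
have eta'E : eta' = U *: eta.
  apply: (form_div_inj nF); rewrite /= /form_div loc_formZ.
  have eF' : \prod_i f' i = U * F.
    rewrite [X in U * X](reindex_inj (@perm_inj _ s)) -big_split.
    by apply: eq_bigr => i _; apply: f'E.
  have uF' := frac_embed_unit nF'; have uF := frac_embed_unit nF.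
  have -> : loc_form eta' = frac_embed (U * F) *: omega.
    by rewrite omegaE' eF' scalerA divrr -?eF' // scale1r.
  have -> : loc_form eta = frac_embed F *: omega by rewrite omegaE scalerA divrr // scale1r.
  by rewrite !scalerA rmorphM mulrA.
have h1 := LR_mod mem_factor nF omegaE hLR.
pose sg : R := (-1) ^+ s.
have h2 w : K (b' * eta w - sg * theta (of_form gamma') p w).
  apply: (ideal_cancel_invertible iU).
  pose t i : {linear M -> R^o} := u i \*: differential (f (s i)).
  have tE : wedges t gamma' = (U * sg) *: wedges df gamma'.
    rewrite (@wedges_scale _ _ _ _ t (fun i => df (s i)) u) //.
    by rewrite (wedges_perm df) scalerA.
  have C x : K (wedges (fun i => differential (f' i)) gamma' x - wedges t gamma' x).
    by apply: (wedges_congr _ hK) => i X; apply: der_associated.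
  have {C}C := cast_form_eqP (subnKC hkp) (K := K) C w.
  have f'I i : K (f' i) by rewrite f'E; apply: (idealM hK); apply: mem_factor.
  have h := LR_mod f'I nF' omegaE' hLR' w.
  have {}C : K (gwedges (fun i => differential (f' i)) (enum 'I_k) (of_form gamma') p w -
      U * sg * theta (of_form gamma') p w).
    by move: C; rewrite tE cast_formZ /theta -!cast_wedges of_form_id.
  have := idealD hK h C; rewrite addrA subrK eta'E formZE.
  by rewrite mulrBr mulrCA !mulrA.
(* Modulo [I], theta [/\ gamma] is [b *: eta] and theta [/\ gamma'] is [b' *: eta] up to the sign
   [sg], so theta kills [beta]. *)
pose beta := b' *: of_form gamma - (sg * b) *: of_form gamma'.
have hb : gform_in K (theta beta).
  move=> q w; have [e_pq|ne] := pselect (p = q); last first.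
    rewrite /theta gwedges_eq0 ?form0E; first exact: rpred0.
    move=> d; rewrite size_enum_ord => hd; rewrite /beta gformDE gformNE !gformZE.
    have nd : (p - k)%N <> d by move=> ed; apply: ne; rewrite -hd -ed subnKC.
    by rewrite !of_form_ne // !scaler0 subr0.
  have tb : theta beta =
      b' *: theta (of_form gamma) - (sg * b) *: theta (of_form gamma').
    by rewrite /theta /beta linearB /= ![gwedges _ _ (_ *: _)]linearZ.
  subst q; rewrite tb.
  rewrite -[X in K X]/(b' * theta (of_form gamma) p w - sg * b * theta (of_form gamma') p w).
  rewrite (_ : _ - _ = b * (b' * eta w - sg * theta (of_form gamma') p w) -
      b' * (b * eta w - theta (of_form gamma) p w)); last by ring.
  by apply: (idealB hK); apply: (idealM hK); [apply: h2 | apply: h1].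
pose x j := qrep (lnum (v j)).
have hx : K (b' * gamma x - sg * b * gamma' x).
  have [n hn] := coef_ideal_exponent e df.
  have [z Fz hz] := (hn a Ja K hK).1 beta hb.
  (* [a ^+ n *: beta] is congruent to [z], which vanishes modulo [I] on the common kernel; the power
     of [a] then cancels. *)
  apply: (nzd_modX (n := n) na).
  have Kz : K (z (p - k)%N x).
    by apply: (wedge_filtration_eval hK _ Fz) => i j; have /in_kernelP := hv j; apply.
  have := idealD hK (hz _ x) Kz.
  rewrite [(a ^+ n *: beta - z) _ x]/(_ - _) subrK.
  by rewrite gformZE /beta gformDE gformNE !gformZE !of_form_id.
have {}hx : mkres I b' * mkres I (gamma x) = (-1) ^+ s * (mkres I b * mkres I (gamma' x)).
  move: hx => /mkres_eqP; rewrite !mkresM => ->.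
  by rewrite /sg rmorph_sign mulrA.
have ub := frac_embed_unit nb; have ub' := frac_embed_unit nb'.
rewrite /residue_form !formZE /= /loc_form_fun /= /quot_form_fun !mkfracE.
rewrite -/x !mulrA; congr (_ / _).
apply: signed_cross_mul => //.
by have := congr1 (@frac_embed _) hx; rewrite !rmorphM rmorph_sign.
Qed.

End Residue.

End Main.

Lemma reduced_factor_bij (R : comNzRingType) m (e : 'I_m -> Der R) p
    (omega : extform (localized (Der R)) p) (eta eta' : extform (Der R) p)
    k (f : 'I_k -> R) k' (f' : 'I_k' -> R) : is_basis e ->
  reduced_repr f omega eta -> reduced_repr f' omega eta' ->
  exists2 t : 'I_k' -> 'I_k, injective t & forall i, associated (f' i) (f (t i)).
Proof.
move=> he hw hw'.
have /choice[t ht] i : exists j, associated (f' i) (f j).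
  by have [j /associated_sym] := reduced_factor he hw' hw i; exists j.
(* Two factors of [f'] sent to the same [f j] would be associated, against reducedness. *)
exists t => // i j etij; apply: contrapT => /eqP ij.
have [_ na _ _ _] := hw'; apply: (na i j ij).
by apply: associated_trans (ht i) _; rewrite etij; apply: associated_sym.
Qed.

Theorem theorem4p2 (R : comNzRingType) (m k p : nat)
  (e : 'I_m -> Der R) (he : is_basis e)
  (hk : (1 <= k)%N) (hkm : (k <= m)%N) (hkp : (k <= p)%N)
  (f : 'I_k -> R) (I : idealr R)
  (hI : forall x, x \in (I : {pred R}) <-> in_gen f x)
  (omega : extform (localized (Der R)) p) (eta : extform (Der R) p)
  (hw : reduced_repr f omega eta) :
  (log_condition f omega ->
     exists n : nat, forall a : R, coef_ideal e (dwedge f) a ->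
       exists gamma : extform (Der R) (p - k), LR hkp f (a ^+ n) omega gamma)
  /\
  (log_condition f omega ->
     depth_ge (coef_ideal (fun i => mkquot I (e i)) (dwedge_bar I f)) (p - k + 2) ->
       exists gamma : extform (Der R) (p - k), LR hkp f 1 omega gamma)
  /\
  (is_ufd R ->
     forall (k' : nat) (f' : 'I_k' -> R) (eta' : extform (Der R) p),
       reduced_repr f' omega eta' ->
       exists (ek : k' = k) (s : 'S_k),
         let g := fun i : 'I_k => f' (cast_ord (esym ek) i) in
         [/\ forall i, associated (g i) (f (s i)),
             forall x, x \in (I : {pred R}) <-> in_gen g x,
             forall x, in_kernel I g x <-> in_kernel I f x
           & (exists2 a : R, coef_ideal e (dwedge f) a & nzd (mkres I a)) ->
             forall (b b' : R) (gamma gamma' : extform (Der R) (p - k)),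
               nzd (mkres I b) -> nzd (mkres I b') ->
               LR hkp f b omega gamma -> LR hkp g b' omega gamma' ->
               forall v : 'I_(p - k) -> localized (quotmod I (Der R)),
                 (forall j, in_kernel I f (v j)) ->
                 residue_form I b' gamma' v =
                 (-1) ^+ s * residue_form I b gamma v]).
Proof.
have [_ _ _ [nF _ _ _] eF] := hw.
split; first exact: (log_form_power he hkp hI nF eF).
split; first exact: (log_form_depth he hkp hI nF eF).
move=> _ k' f' eta' hw'.
have [t t_inj ft] := reduced_factor_bij he hw hw'.
have [t' t'_inj _] := reduced_factor_bij he hw' hw.
have ek : k' = k.
  apply/eqP; rewrite eqn_leq.
  by have := leq_card t t_inj; have := leq_card t' t'_inj; rewrite !card_ord => -> ->.
subst k'; exists erefl, (perm t_inj).
have -> : (fun i : 'I_k => f' (cast_ord (esym erefl) i)) = f'.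
  by apply: funext => i; rewrite cast_ord_id.
have [_ _ _ [nF' _ _ _] eF'] := hw'.
have /choice[u hu] i : exists u, invertible u /\ f' i = u * f (perm t_inj i).
  by rewrite permE; have [u iu e_u] := ft i; exists u.
have iu i := (hu i).1; have eu i := (hu i).2.
split=> [i|x|x|].
- by exists (u i).
- exact: (mem_associated_gens hI iu eu).
- have D X i : (X : Der R) (f' i) \in (I : {pred R}) <-> X (f (perm t_inj i)) \in (I : {pred R}).
    exact: (der_associated_mem hI iu eu).
  rewrite !in_kernelP; split=> h i; last exact/D.
  by have /D := h ((perm t_inj)^-1 i)%g; rewrite permKV.
- move=> [a Ja na] b b' gamma gamma' nb nb' hLR hLR' v hv.
  exact: (residue_unique hI nF eF nF' eF' iu eu Ja na nb nb' hLR hLR' hv).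
Qed.
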